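(* Let $\varepsilon>0$ and $F\in(1,\infty)$ be fixed. Let $p,q\ge 2$ and $s\in\mathbb{R}$. If there is a constant $C$ such that the estimate $$\left\Vert e^{\pm\frac1\varepsilon itp_F(D)}g\right\Vert_{L^p_tL^q_x}\le C\Vert g\Vert_{\dot H^s}$$ holds for all $g\in\dot H^s(\mathbb{R}^3)$, then necessarily $$\frac2p+\frac1q\le\frac12\qquad\text{and}\qquad s=3\left(\frac12-\frac1q\right).$$
   Context: For $\xi=(\xi_1,\xi_2,\xi_3)\in\mathbb{R}^3$ let $|\xi|_F=|(\xi_1,\xi_2,F\xi_3)|$ and $p_F(\xi)=\dfrac{|\xi|_F}{F|\xi|}$. The operator $e^{\pm\frac1\varepsilon itp_F(D)}$ is defined by $$e^{\pm \frac1\varepsilon itp_F(D)}g:(t,x)\longmapsto\int_{\mathbb{R}^3}e^{ix\cdot\xi\pm\frac1\varepsilon itp_F(\xi)}\hat g(\xi)\,d\xi$$ (understood as an inverse Fourier transform, by density, when the integral is not absolutely convergent), with $\hat g(\xi)=\int_{\mathbb{R}^3} e^{-ix\cdot\xi}g(x)\,dx$. Norms: $\Vert u\Vert_{L^p_tL^q_x}$ is the norm of $L^p(\mathbb{R},L^q(\mathbb{R}^3))$ (time ranges over all of $\mathbb{R}$); $\Vert g\Vert_{\dot H^s}=\left(\int_{\mathbb{R}^3}|\hat g(\xi)|^2|\xi|^{2s}d\xi\right)^{1/2}$. *)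

(* Defs.v *)
From HB Require Import structures.
From mathcomp Require Import all_boot all_order all_algebra.
From mathcomp Require Import all_classical all_reals all_analysis.
From mathcomp Require Import complex.

Set Implicit Arguments.
Unset Strict Implicit.
Unset Printing Implicit Defensive.

Import Order.TTheory GRing.Theory Num.Theory.
Import numFieldNormedType.Exports.
Import ComplexField.Normc.

Local Open Scope classical_set_scope.
Local Open Scope ring_scope.
Local Open Scope complex_scope.

(* [measurableTypeR R] is [R] with its Borel sigma-algebra, the carrier on
   which the library puts Lebesgue measure. *)
Notation R3 R :=
  (measurableTypeR R * measurableTypeR R * measurableTypeR R)%type.

Definition lebesgue3 (R : realType) : {measure set R3 R -> \bar R} :=
  ((@lebesgue_measure R \x @lebesgue_measure R) \x @lebesgue_measure R)%E.

Section Definitions.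
Variable R : realType.
Implicit Types (x y xi : R3 R) (f phi psi : R3 R -> R[i])
  (T : (R3 R -> R[i]) -> R[i]).

Definition dot x y : R :=
  x.1.1 * y.1.1 + x.1.2 * y.1.2 + x.2 * y.2.

(* The library norm on a product is the max norm. *)
Definition enorm x : R := Num.sqrt (dot x x).

Definition enormF (F : R) x : R := enorm (x.1, F * x.2).

Definition pF (F : R) xi : R := enormF F xi / (F * enorm xi).

Definition expi (theta : R) : R[i] := cos theta +i* sin theta.

Definition cmeasurable f : Prop :=
  measurable_fun [set: R3 R] (fun x => complex.Re (f x)) /\
  measurable_fun [set: R3 R] (fun x => complex.Im (f x)).

Definition cintegrable f : Prop :=
  (lebesgue3 R).-integrable [set: R3 R] (fun x => (complex.Re (f x))%:E) /\
  (lebesgue3 R).-integrable [set: R3 R] (fun x => (complex.Im (f x))%:E).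

Definition cintegral f : R[i] :=
  (\int[lebesgue3 R]_x complex.Re (f x)) +i*
  (\int[lebesgue3 R]_x complex.Im (f x)).

Definition clocally_integrable f : Prop :=
  cmeasurable f /\
  forall K : set (R3 R), compact K ->
    (\int[lebesgue3 R]_(x in K) (normc (f x))%:E < +oo)%E.

Definition fourier f xi : R[i] :=
  cintegral (fun x => expi (- dot x xi) * f x).

(* Without the factor (2 pi)^-3, so that [ifourier \o fourier] is
   (2 pi)^3 times the identity. *)
Definition ifourier f x : R[i] :=
  cintegral (fun xi => expi (dot x xi) * f xi).

Definition basis3 (j : 'I_3) : R3 R :=
  ((j == 0 :> nat)%N%:R, (j == 1 :> nat)%N%:R, (j == 2 :> nat)%N%:R).

(* Iterated partial derivatives, indexed by words in the coordinates. *)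
Definition partial (w : seq 'I_3) (h : R3 R -> R) : R3 R -> R :=
  foldr (fun j k => 'D_(basis3 j) k) h w.

Definition cpartial (w : seq 'I_3) phi x : R[i] :=
  partial w (fun y => complex.Re (phi y)) x +i*
  partial w (fun y => complex.Im (phi y)) x.

Definition schwartz phi : Prop :=
  (forall (w : seq 'I_3) x,
     differentiable (partial w (fun y => complex.Re (phi y))) x /\
     differentiable (partial w (fun y => complex.Im (phi y))) x) /\
  (forall (w : seq 'I_3) (N : nat), exists M : R, forall x,
     (1 + enorm x) ^+ N * normc (cpartial w phi x) <= M).

(* Tempered distributions are functionals on all functions, of which only the
   values on Schwartz functions matter: linearity, and continuity in the form
   of a bound by a single Schwartz seminorm. *)
Definition tempered T : Prop :=
  (forall (a : R[i]) phi psi, schwartz phi -> schwartz psi ->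
     T (fun x => a * phi x + psi x) = a * T phi + T psi) /\
  exists (N : nat) (C : R), forall phi (M : R), schwartz phi ->
    (forall (w : seq 'I_3) x, (size w <= N)%N ->
       (1 + enorm x) ^+ N * normc (cpartial w phi x) <= M) ->
    normc (T phi) <= C * M.

Definition regular f : (R3 R -> R[i]) -> R[i] :=
  fun phi => cintegral (fun x => f x * phi x).

Definition dfourier T : (R3 R -> R[i]) -> R[i] := fun phi => T (fourier phi).
Definition difourier T : (R3 R -> R[i]) -> R[i] := fun phi => T (ifourier phi).

Definition is_function T f : Prop :=
  clocally_integrable f /\
  forall phi, schwartz phi ->
    cintegrable (fun x => f x * phi x) /\ T phi = regular f phi.

Definition Lq_norm (q : \bar R) f : \bar R :=
  ('N[lebesgue3 R]_q [ (fun x => (normc (f x))%:E) ])%E.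

(* +oo when [T] is not a function: the infimum ranges over the functions
   (unique almost everywhere) that represent [T]. *)
Definition dist_Lq_norm (q : \bar R) T : \bar R :=
  ereal_inf (Lq_norm q @` [set f | is_function T f]).

Definition LpLq_norm (p q : \bar R) (u : R -> (R3 R -> R[i]) -> R[i])
    : \bar R :=
  ('N[@lebesgue_measure R]_p [ (fun t => dist_Lq_norm q (u t)) ])%E.

(* The argument is the Fourier transform of the element of H^s. *)
Definition Hdot_norm (s : R) (ghat : R3 R -> R[i]) : \bar R :=
  ((\int[lebesgue3 R]_xi
      (normc (ghat xi) ^+ 2 * enorm xi `^ (2 * s))%:E) `^ (1 / 2))%E.

(* [g] is in the homogeneous Sobolev space of order [s] and its Fourier
   transform is the (locally integrable) function [ghat]. *)
Definition in_Hdot (s : R) (g : (R3 R -> R[i]) -> R[i])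
    (ghat : R3 R -> R[i]) : Prop :=
  [/\ tempered g, is_function (dfourier g) ghat & (Hdot_norm s ghat < +oo)%E].

(* e^{+-(1/eps) i t p_F(D)} g in terms of the Fourier transform of g, the sign
   being (-1)^sgn. The inverse Fourier transform is that of tempered
   distributions; when [ghat] is integrable the result is represented by the
   function [ifourier (fun xi => expi (...) * ghat xi)]. *)
Definition propagator (eps F : R) (sgn : bool) (ghat : R3 R -> R[i]) (t : R)
    : (R3 R -> R[i]) -> R[i] :=
  difourier (regular (fun xi =>
    expi ((-1) ^+ sgn * (eps^-1 * t * pF F xi)) * ghat xi)).

End Definitions.

(* Main.v *)
Require Import Defs.
From HB Require Import structures.
From mathcomp Require Import all_boot all_order all_algebra.
From mathcomp Require Import all_classical all_reals all_analysis.
From mathcomp Require Import measurable_realfun ess_sup_inf.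
From mathcomp Require Import complex ring lra.
Set Implicit Arguments.
Unset Strict Implicit.
Unset Printing Implicit Defensive.
Import Order.TTheory GRing.Theory Num.Theory.
Import numFieldNormedType.Exports.
Import ComplexField.Normc.
Local Open Scope classical_set_scope.
Local Open Scope ring_scope.

(** The estimate fails outside the stated range because of wave packets that
    do not disperse.  Two features of the symbol matter: it is homogeneous of
    degree 0, and it is stationary, with value 1/F, along the whole plane
    xi_3 = 0, in the sense that |p_F(xi) - 1/F| xi_1^2 <= F xi_3^2
    ([pF_stationary]).  Take b >= a > 0 and a datum whose Fourier transform is
    concentrated where |xi_1|, |xi_2| ~ a^(-1/2) and |xi_3| <~ b^(-1/2).  As
    long as |t| <~ eps b/a the evolution multiplies the datum by an almost
    constant phase, so that the solution keeps the size (a b^(1/2))^-1 of the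
    volume of its frequency box on the dual box of volume a b^(1/2).  Hence
    the estimate implies, for all 0 < a <= b,

      (b/a)^(1/p) (a b^(1/2))^(-(1 - 1/q))
        <= D (a^(-s) a^(-1) b^(-1/2))^(1/2)

    ([strichartz_packets]).  For b = a this compares two powers of a: letting
    a tend to 0 and to infinity forces s = 3 (1/2 - 1/q)
    ([scaling_exponent]).  For a = 1 and b tending to infinity the packets
    flatten onto the plane where the symbol is stationary, as in Knapp's
    example, and 2/p + 1/q <= 1/2 follows ([knapp_exponent]).

    All functions involved are built from Gaussians, which makes their Fourier
    transforms explicit and dispenses with Fourier inversion.

    The packet is a Gaussian times (1 - e^(-M a xi_1^2/2))^k.  The extra factor
    vanishes at xi_1 = 0: to high order, which makes the Sobolev norm finite
    when s is very negative ([packet_sobolev]), and at least to second order,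
    which absorbs the 1/xi_1^2 in the bound on the phase ([packet_upper]).
    Expanded, the packet is a combination of Gaussians, hence the Fourier
    transform of an integrable function G ([packet_fourier_pair]); that it is
    also the distributional Fourier transform of G is the multiplication
    formula, that is, Fubini's theorem ([is_function_fourier]).

    The L^q norm of the solution at time t, an infimum over the functions that
    represent a distribution, is bounded below by duality: the distribution is
    large on one Gaussian test function g ([propagator_packet_ge]), and
    Hoelder's inequality turns this into a bound on every function that
    represents it ([dist_Lq_norm_ge]).  The resulting bound is constant on a
    time interval, and integrating it uses that integrals of non-negative
    functions are monotone even if the functions are not measurable
    ([LpLq_norm_ge]). *)

(** * Integration *)

Section Integrable.
Context d (T : measurableType d) (R : realType).
Variable mu : {measure set T -> \bar R}.
Implicit Types f g : T -> R.

Lemma integrable_measurable f : mu.-integrable setT (fun x => (f x)%:E) ->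
  measurable_fun setT f.
Proof. by case/integrableP => /measurable_EFinP. Qed.

Lemma integrable_scale (k : R) f : mu.-integrable setT (fun x => (f x)%:E) ->
  mu.-integrable setT (fun x => (k * f x)%:E).
Proof. by move=> /(integrableZl measurableT k). Qed.

Lemma integrable_add f g : mu.-integrable setT (fun x => (f x)%:E) ->
  mu.-integrable setT (fun x => (g x)%:E) ->
  mu.-integrable setT (fun x => (f x + g x)%:E).
Proof. by move=> intf intg; have := integrableD measurableT intf intg. Qed.

Lemma integrable_sub f g : mu.-integrable setT (fun x => (f x)%:E) ->
  mu.-integrable setT (fun x => (g x)%:E) ->
  mu.-integrable setT (fun x => (f x - g x)%:E).
Proof. by move=> intf intg; have := integrableB measurableT intf intg. Qed.

Lemma integrable_le f g : measurable_fun setT f -> (forall x, `|f x| <= g x) ->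
  mu.-integrable setT (fun x => (g x)%:E) ->
  mu.-integrable setT (fun x => (f x)%:E).
Proof.
move=> mf fg; apply: le_integrable => //; first exact/measurable_EFinP.
move=> x _; rewrite !abse_EFin lee_fin (le_trans (fg x))//; exact: ler_norm.
Qed.

Lemma integrable_mulb f g M : measurable_fun setT f -> (forall x, `|f x| <= M) ->
  mu.-integrable setT (fun x => (g x)%:E) ->
  mu.-integrable setT (fun x => (f x * g x)%:E).
Proof.
move=> mf fM intg; apply: (@integrable_le _ (fun x => M * `|g x|)).
- by apply: measurable_funM => //; exact: integrable_measurable.
- by move=> x; rewrite normrM ler_wpM2r.
- by apply: integrable_scale; exact: integrable_norm.
Qed.

Lemma EFin_Rintegral f : mu.-integrable setT (fun x => (f x)%:E) ->
  ((\int[mu]_x f x)%:E = \int[mu]_x (f x)%:E)%E.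
Proof.
by move=> intf; rewrite /Rintegral fineK// (integrable_fin_num measurableT intf).
Qed.

Lemma Rintegral_eq0 f : (forall x, f x = 0) -> \int[mu]_x f x = 0.
Proof. by move=> f0; rewrite /Rintegral integral0_eq// => x _; rewrite f0. Qed.

(** The integral of a non-negative function is a supremum over the simple
    functions below it, and is therefore monotone for arbitrary functions.
    This is used for the norm of u(t) as a function of t, which is not known to
    be measurable, and for integrals over compact sets. *)
Lemma ge0_le_integralT (f g : T -> \bar R) : (forall x, 0 <= f x)%E ->
  (forall x, f x <= g x)%E -> (\int[mu]_x f x <= \int[mu]_x g x)%E.
Proof.
move=> f0 fg; rewrite !ge0_integralTE//; last by move=> x; exact: le_trans (fg x).
apply: le_ereal_sup => _ [h /= hf <-]; exists h => // x.
exact: le_trans (hf x) (fg x).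
Qed.

Lemma measurable_cosT f :
  measurable_fun setT f -> measurable_fun setT (fun x => cos (f x)).
Proof.
move=> mf; apply: (measurableT_comp _ mf).
by apply: continuous_measurable_fun; exact: continuous_cos.
Qed.

Lemma measurable_sinT f :
  measurable_fun setT f -> measurable_fun setT (fun x => sin (f x)).
Proof.
move=> mf; apply: (measurableT_comp _ mf).
by apply: continuous_measurable_fun; exact: continuous_sin.
Qed.

End Integrable.

Lemma measurable_affine (R : realType) (a b : R) :
  measurable_fun setT (fun x : R => a * x + b).
Proof. by apply: measurable_funD => //; exact: measurable_funM. Qed.

(** * The Fourier transform of a Gaussian on the line *)

Section Gauss1.
Variable R : realType.
Implicit Types (c x xi b : R).
Local Notation mu := (@lebesgue_measure R).

Definition gauss c x : R := expR (- (c * x ^+ 2 / 2)).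

Lemma gauss_gt0 c x : 0 < gauss c x. Proof. exact: expR_gt0. Qed.
Lemma gauss_ge0 c x : 0 <= gauss c x. Proof. exact: expR_ge0. Qed.
Lemma gauss_le1 c x : 0 <= c -> gauss c x <= 1.
Proof.
move=> c0; rewrite -expR0 ler_expR oppr_le0.
by rewrite divr_ge0// mulr_ge0// sqr_ge0.
Qed.

Lemma gauss_normal c : 0 < c ->
  gauss c = normal_fun 0 (Num.sqrt c)^-1.
Proof.
move=> c0; apply/funext => x; rewrite /gauss /normal_fun subr0.
rewrite exprVn sqr_sqrtr ?ltW//; congr expR; field.
by rewrite gt_eqF.
Qed.

Lemma measurable_gauss c D : measurable_fun D (gauss c).
Proof.
apply: measurable_funTS; rewrite /gauss; apply: measurableT_comp => //.
apply: measurableT_comp => //; apply: measurable_funM => //.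
by apply: measurable_funM => //; exact: measurable_funX.
Qed.

Lemma integral_gauss c : 0 < c ->
  (\int[mu]_x (gauss c x)%:E = (Num.sqrt (2 * pi / c))%:E)%E.
Proof.
move=> c0.
have sc0 : 0 < Num.sqrt c by rewrite sqrtr_gt0.
have s0 : (Num.sqrt c)^-1 != 0 by rewrite invr_neq0// gt_eqF.
have p0 := normal_peak_gt0 s0.
have := integral_normal_pdf 0 (Num.sqrt c)^-1.
under eq_integral do rewrite /normal_pdf (negbTE s0) -gauss_normal// EFinM.
rewrite ge0_integralZl_EFin//; last 3 first.
- by move=> x _; rewrite lee_fin gauss_ge0.
- by apply/measurable_EFinP; exact: measurable_gauss.
- exact: normal_peak_ge0.
move=> h.
have -> : (\int[mu]_x (gauss c x)%:E = (normal_peak (Num.sqrt c)^-1)^-1%:E *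
    ((normal_peak (Num.sqrt c)^-1)%:E * \int[mu]_x (gauss c x)%:E))%E.
  by rewrite muleA -EFinM mulVf ?mul1e// gt_eqF.
rewrite h mule1 /normal_peak invrK exprVn sqr_sqrtr ?ltW//; congr (Num.sqrt _)%:E.
by field; rewrite gt_eqF.
Qed.

Lemma integrable_gauss c : 0 < c -> mu.-integrable setT (EFin \o gauss c).
Proof.
move=> c0; apply/integrableP; split.
  by apply/measurable_EFinP; exact: measurable_gauss.
under eq_integral do rewrite /= ger0_norm ?gauss_ge0//.
by rewrite integral_gauss// ltry.
Qed.

(** A linear factor costs half of the Gaussian decay. *)
Lemma norm_le_gauss c : 0 < c ->
  exists K, 0 <= K /\ forall x, `|x| * gauss c x <= K * gauss (c / 2) x.
Proof.
move=> c0; exists (1 + 4 / c); split; first by rewrite addr_ge0// divr_ge0// ltW.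
move=> x.
have -> : gauss c x = gauss (c / 2) x * gauss (c / 2) x.
  by rewrite /gauss -expRD; congr expR; field.
rewrite mulrA ler_pM2r ?gauss_gt0//.
rewrite /gauss expRN ler_pdivrMr ?expR_gt0//.
apply: (@le_trans _ _ ((1 + 4 / c) * (1 + c / 2 * x ^+ 2 / 2))); last first.
  by rewrite ler_pM2l ?expR_ge1Dx// ltr_pwDl// divr_ge0// ltW.
have -> : (1 + 4 / c) * (1 + c / 2 * x ^+ 2 / 2) =
   1 + x ^+ 2 + 4 / c + (c * x ^+ 2 / 4).
  by field; rewrite gt_eqF.
have : 0 <= 4 / c by rewrite divr_ge0// ltW.
have : 0 <= c * x ^+ 2 / 4 by rewrite divr_ge0// mulr_ge0 ?sqr_ge0// ltW.
rewrite -(real_normK (num_real x)); move: (normr_ge0 x) => ? ? ?.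
have : 0 <= (`|x| - 1) ^+ 2 by exact: sqr_ge0.
nra.
Qed.

Lemma is_derive_gauss c x : is_derive x 1 (gauss c) (- (c * x) * gauss c x).
Proof.
rewrite /gauss; apply: is_derive_eq.
by rewrite !scaler1 /GRing.scale/=; field.
Qed.

Lemma cvg_gauss_nat c : 0 < c -> gauss c n.+1%:R @[n --> \oo] --> (0 : R).
Proof.
move=> c0.
apply: (@squeeze_cvgr _ _ _ _ (fun=> 0) (fun n => (2 / c) * harmonic n)).
- apply: nearW => n; rewrite gauss_ge0/= /gauss expRN.
  have n1 : 1 <= n.+1%:R :> R by rewrite ler1n.
  have cn : 0 < c / 2 * n.+1%:R by rewrite mulr_gt0// divr_gt0.
  have -> : 2 / c * harmonic n = (c / 2 * n.+1%:R)^-1.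
    by rewrite /harmonic/= invfM invf_div.
  rewrite lef_pV2 ?posrE ?expR_gt0//.
  apply: (le_trans _ (expR_ge1Dx _)).
  by nra.
- exact: cvg_cst.
- rewrite -[X in _ --> X](mulr0 (2 / c)); apply: cvgM; first exact: cvg_cst.
  exact: cvg_harmonic.
Qed.

Lemma integrable_bounded_gauss c (h : R -> R) (a b : R) : 0 < c -> 0 <= a -> 0 <= b ->
  measurable_fun setT h -> (forall x, `|h x| <= a + b * `|x|) ->
  mu.-integrable setT (fun x => (h x * gauss c x)%:E).
Proof.
move=> c0 a0 b0 mh hab.
have [K [K0 HK]] := norm_le_gauss c0.
have c20 : 0 < c / 2 by rewrite divr_gt0.
apply: (@le_integrable _ _ _ mu setT measurableT _
    ((fun x => a%:E * (gauss c x)%:E) \+ (fun x => (b * K)%:E * (gauss (c / 2) x)%:E))%E).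
- by apply/measurable_EFinP; apply: measurable_funM => //; exact: measurable_gauss.
- move=> x _; rewrite -!EFinM -EFinD !abse_EFin lee_fin.
  rewrite [leRHS]ger0_norm; last first.
    by rewrite addr_ge0// !mulr_ge0 ?gauss_ge0.
  rewrite normrM (ger0_norm (gauss_ge0 _ _)).
  apply: (@le_trans _ _ ((a + b * `|x|) * gauss c x)).
    by rewrite ler_wpM2r ?gauss_ge0.
  by rewrite mulrDl lerD2l -!mulrA ler_wpM2l.
- by apply: integrableD => //; apply: integrableZl => //; exact: integrable_gauss.
Qed.

(** The integrand is the derivative of sin(xi x + b) e^(-c x^2/2), which
    vanishes at infinity. *)
Lemma integral_dgauss c xi b : 0 < c ->
  \int[mu]_x ((xi * cos (xi * x + b) - c * (x * sin (xi * x + b))) * gauss c x) = 0.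
Proof.
move=> c0.
pose h x := (xi * cos (xi * x + b) - c * (x * sin (xi * x + b))).
pose f x := h x * gauss c x.
pose H x := sin (xi * x + b) * gauss c x.
have dH x : is_derive x (1:R) H (f x).
  have ? := is_derive_gauss c x.
  rewrite /H; apply: is_derive_eq.
  by rewrite /f /h /GRing.scale/=; ring.
have cf : continuous f.
  move=> x; apply: (@differentiable_continuous _ R^o R^o); apply/derivable1_diffP.
  have ? := is_derive_gauss c x.
  by rewrite /f /h; apply: ex_derive.
have intf : mu.-integrable setT (EFin \o f).
  apply: (@integrable_bounded_gauss c h `|xi| `|c|) => //.
    apply: measurable_funB; apply: measurable_funM => //.
      by apply: measurable_cosT; exact: measurable_affine.
    by apply: measurable_funM => //; by apply: measurable_sinT; exact: measurable_affine.
  move=> x; rewrite /h (le_trans (ler_normB _ _))// !normrM lerD//.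
    by rewrite ler_piMr// cos_max.
  by rewrite ler_wpM2l// ler_piMr// sin_max.
pose D (n : nat) : set R := `[- n.+1%:R, n.+1%:R]%classic.
have FTC n : (\int[mu]_(x in D n) (f x)%:E = (H n.+1%:R)%:E - (H (- n.+1%:R))%:E)%E.
  apply: continuous_FTC2.
  - by rewrite gtrN.
  - exact: continuous_subspaceT.
  - split.
    + by move=> x _; apply: ex_derive.
    + apply: cvg_at_right_filter.
      by apply: (@differentiable_continuous _ R^o R^o); apply/derivable1_diffP; apply: ex_derive.
    + apply: cvg_at_left_filter.
      by apply: (@differentiable_continuous _ R^o R^o); apply/derivable1_diffP; apply: ex_derive.
  - by move=> x _; rewrite derive1E; apply: derive_val.
(* the primitive tends to 0 at both ends of the interval D n *)
have lim0 : (\int[mu]_(x in D n) (f x)%:E)%E @[n --> \oo] --> 0%:E.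
  under eq_fun do rewrite FTC -EFinB.
  apply: cvg_EFin; first by apply: nearW.
  apply: norm_cvg0.
  apply: (@squeeze_cvgr _ _ _ _ (fun=> 0) (fun n => 2 * gauss c n.+1%:R)).
  - apply: nearW => n; rewrite normr_ge0/= (le_trans (ler_normB _ _))//.
    rewrite mulr_natl mulr2n /H !normrM !(ger0_norm (gauss_ge0 _ _)).
    have -> : gauss c (- n.+1%:R) = gauss c n.+1%:R by rewrite /gauss sqrrN.
    by rewrite lerD// ler_piMl ?gauss_ge0// sin_max.
  - exact: cvg_cst.
  - rewrite -[X in _ --> X](mulr0 2); apply: cvgM; first exact: cvg_cst.
    exact: cvg_gauss_nat.
have mf : measurable_fun setT f by exact: continuous_measurable_fun.
have D1 n : measurable_fun setT ((EFin \o f) \_ (D n)).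
  apply/(measurable_restrictT _ _).1 => //; first exact: measurable_itv.
  by apply: measurable_funTS; apply/measurable_EFinP.
have D2 : {ae mu, forall x, setT x -> ((EFin \o f) \_ (D n)) x @[n --> \oo] --> (EFin \o f) x}.
  apply/aeW => x _; apply: cvg_near_cst.
  have [N Nx] : exists N : nat, `|x| <= N%:R.
    by exists (Num.truncn `|x|).+1; apply/ltW; exact: truncnS_gt.
  exists N => //= n /= Nn; rewrite patchE mem_set//= /D/= in_itv/= -ler_norml.
  by rewrite (le_trans Nx)// ler_nat (leq_trans Nn).
have D3 : {ae mu, forall x n, setT x -> (`|((EFin \o f) \_ (D n)) x| <= (abse \o (EFin \o f)) x)%E}.
  by apply/aeW => x n _; rewrite patchE; case: ifP => //= _; rewrite normr0 lee_fin.
have D4 : measurable_fun setT (EFin \o f) by apply/measurable_EFinP.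
have D5 := integrable_abse intf.
have [_ _ limf] :=
  @dominated_convergence _ _ R mu setT measurableT _ _ _ D1 D4 D2 D5 D3.
have : 0%E = (\int[mu]_x (EFin \o f) x)%E.
  apply: (cvg_unique _ lim0) => //.
  rewrite /=; under eq_fun do rewrite integral_mkcond.
  exact: limf.
by rewrite /Rintegral /f /h => <-.
Qed.

(** The phase b makes this the cosine transform (b = 0) and the sine transform
    (b = - pi/2) of the Gaussian at once; both solve the same equation. *)
Definition gauss_cos c b xi : R := \int[mu]_x (cos (xi * x + b) * gauss c x).

Lemma integrable_cos_gauss c b xi : 0 < c ->
  mu.-integrable setT (fun x => (cos (xi * x + b) * gauss c x)%:E).
Proof.
move=> c0; apply: (@integrable_bounded_gauss c _ 1 0) => //.
  by apply: measurable_cosT; exact: measurable_affine.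
by move=> x; rewrite mul0r addr0 cos_max.
Qed.

Lemma integrable_xsin_gauss c b xi : 0 < c ->
  mu.-integrable setT (fun x => (- (x * sin (xi * x + b)) * gauss c x)%:E).
Proof.
move=> c0; apply: (@integrable_bounded_gauss c _ 0 1) => //.
  apply: measurableT_comp => //; apply: measurable_funM => //.
  by apply: measurable_sinT; exact: measurable_affine.
by move=> x; rewrite normrN normrM add0r mul1r ler_piMr// sin_max.
Qed.

Lemma is_derive_gauss_cos c b xi : 0 < c ->
  is_derive xi (1:R) (gauss_cos c b)
    (\int[mu]_x (- (x * sin (xi * x + b)) * gauss c x)).
Proof.
move=> c0.
pose f xi x := cos (xi * x + b) * gauss c x.
have df x y : is_derive x (1:R) (f ^~ y) (- (y * sin (x * y + b)) * gauss c y).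
  rewrite /f; apply: is_derive_eq.
  by rewrite /GRing.scale/=; ring.
have d1E x y : partial1of2 f x y = - (y * sin (x * y + b)) * gauss c y.
  by rewrite partial1of2E; apply: derive_val.
have Ixi : (`]xi - 1, xi + 1[%classic : set R) xi.
  by rewrite /= in_itv/= ltrBlDr ltrDl ltr01.
have h1 x : (`]xi - 1, xi + 1[%classic : set R) x ->
    mu.-integrable setT (EFin \o f x).
  by move=> _; exact: integrable_cos_gauss.
have h2 x y : (`]xi - 1, xi + 1[%classic : set R) x -> [set: R] y ->
    derivable (f ^~ y) x 1 by move=> _ _; apply: ex_derive.
have h3 y : 0 <= `|y| * gauss c y by rewrite mulr_ge0// gauss_ge0.
have h4 : mu.-integrable setT (EFin \o (fun y => `|y| * gauss c y)).
  apply: (@integrable_bounded_gauss c _ 0 1) => //.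
  by move=> x; rewrite normr_id add0r mul1r.
have h5 x y : (`]xi - 1, xi + 1[%classic : set R) x -> [set: R] y ->
    `|partial1of2 f x y| <= `|y| * gauss c y.
  move=> _ _; rewrite d1E normrM (ger0_norm (gauss_ge0 _ _)) ler_wpM2r ?gauss_ge0//.
  by rewrite normrN normrM ler_piMr// sin_max.
apply: DeriveDef.
  exact: (derivable_under_integral measurableT Ixi h1 h2 h3 h4 h5).
rewrite -derive1E.
rewrite (differentiation_under_integral measurableT Ixi h1 h2 h3 h4 h5).
by apply: eq_Rintegral => x _; rewrite d1E.
Qed.

(** Integration by parts, in the form of [integral_dgauss]. *)
Lemma gauss_cos_ODE c b xi : 0 < c ->
  \int[mu]_x (- (x * sin (xi * x + b)) * gauss c x) = - (xi / c) * gauss_cos c b xi.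
Proof.
move=> c0.
have := integral_dgauss xi b c0.
have -> : (fun x => (xi * cos (xi * x + b) - c * (x * sin (xi * x + b))) * gauss c x) =
  (fun x => xi * (cos (xi * x + b) * gauss c x) + c * (- (x * sin (xi * x + b)) * gauss c x)).
  by apply/funext => x; ring.
rewrite RintegralD//; last 2 first.
- by apply: integrable_scale; exact: integrable_cos_gauss.
- by apply: integrable_scale; exact: integrable_xsin_gauss.
rewrite RintegralZl//; last exact: integrable_cos_gauss.
rewrite RintegralZl//; last exact: integrable_xsin_gauss.
rewrite -/(gauss_cos c b xi) => /eqP; rewrite addrC addr_eq0 => /eqP h.
apply: (mulfI (lt0r_neq0 c0)); rewrite h.
by field; rewrite gt_eqF.
Qed.

(** Differentiation under the integral and [gauss_cos_ODE] give
    K' = - (xi/c) K, so that K(xi) e^(xi^2/(2c)) is constant; at xi = 0 it is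
    the Gaussian integral. *)
Lemma gauss_cosE c b xi : 0 < c ->
  gauss_cos c b xi = cos b * Num.sqrt (2 * pi / c) * gauss c^-1 xi.
Proof.
move=> c0.
pose L xi := gauss_cos c b xi * gauss (- c^-1) xi.
have dL x : is_derive x (1:R) L 0.
  have := is_derive_gauss_cos b x c0; rewrite gauss_cos_ODE// => ?.
  have ? := is_derive_gauss (- c^-1) x.
  rewrite /L; apply: is_derive_eq.
  by rewrite /GRing.scale/=; ring.
have L0 : L 0 = cos b * Num.sqrt (2 * pi / c).
  rewrite /L {1}/gauss expr0n/= mulr0 mul0r oppr0 expR0 mulr1 /gauss_cos.
  under eq_Rintegral do rewrite mul0r add0r.
  rewrite RintegralZl//; last exact: integrable_gauss.
  by rewrite /Rintegral integral_gauss.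
have := is_derive_0_is_cst 0 xi dL; rewrite L0 => ->.
rewrite /L -mulrA -[LHS]mulr1; congr (_ * _).
by rewrite /gauss -expRD -expR0; congr expR; ring.
Qed.

Lemma gauss_sinE c xi : 0 < c -> \int[mu]_x (sin (xi * x) * gauss c x) = 0.
Proof.
move=> c0; have := gauss_cosE (- (pi / 2)) xi c0.
rewrite /gauss_cos cosN cos_pihalf !mul0r => <-.
by apply: eq_Rintegral => x _; rewrite cosBpihalf.
Qed.

End Gauss1.

(** * Measure and integration on R^3 *)

Section Measurable3.
Variable R : realType.
Local Notation mu := (@lebesgue_measure R).

(** An open set is the union of the boxes contained in it that have a rational
    centre and a radius 1/(n+1); there are countably many of them. *)
Lemma open_measurable3 (U : set (R * R * R)%type) :
  open U -> measurable (U : set (R3 R)).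
Proof.
move=> oU.
pose B (p : rat * rat * rat * nat) : set (R3 R) :=
  [set x | ball (ratr p.1.1.1 : R) (p.2.+1%:R^-1 : R) x.1.1] `&`
  [set x | ball (ratr p.1.1.2 : R) (p.2.+1%:R^-1 : R) x.1.2] `&`
  [set x | ball (ratr p.1.2 : R) (p.2.+1%:R^-1 : R) x.2].
pose V p := if `[< B p `<=` U >] then B p else set0.
have mB p : measurable (B p).
  rewrite /B; apply: measurableI; [apply: measurableI|].
  - rewrite -[X in measurable X]setTI;
      apply: (measurableT_comp measurable_fst measurable_fst) => //.
    exact: measurable_ball.
  - rewrite -[X in measurable X]setTI;
      apply: (measurableT_comp measurable_snd measurable_fst) => //.
    exact: measurable_ball.
  - rewrite -[X in measurable X]setTI; apply: measurable_snd => //.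
    exact: measurable_ball.
have -> : U = \bigcup_p V p.
  apply/seteqP; split => [x Ux|x [p _]]; last first.
    by rewrite /V; case: ifPn => // /asboolP; apply.
  have := open_nbhs_nbhs (conj oU Ux); rewrite -nbhs_ballE => -[e /= e0 eU].
  have [n ne] : exists n, n.+1%:R^-1 < e / 2.
    exists (Num.truncn (e / 2)^-1).
    rewrite invf_plt ?posrE// ?divr_gt0// .
    exact: truncnS_gt.
  have n0 : 0 < n.+1%:R^-1 :> R by rewrite invr_gt0.
  have rat_near (y : R) : exists q : rat, `|ratr q - y| < n.+1%:R^-1.
    have /rat_in_itvoo[q] : y - n.+1%:R^-1 < y + n.+1%:R^-1.
      by rewrite ltrD2l gtrN.
    rewrite in_itv/= => /andP[h1 h2]; exists q.
    by rewrite ltr_norml; apply/andP; split; [rewrite ltrBrDr addrC|rewrite ltrBlDr addrC].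
  have [q1 h1] := rat_near x.1.1.
  have [q2 h2] := rat_near x.1.2.
  have [q3 h3] := rat_near x.2.
  exists (q1, q2, q3, n) => //.
  rewrite /V; case: asboolP => [_|]; first by rewrite /B/=; split => //.
  move=> []; move=> y [[/= b1 b2] b3]; apply: eU.
  have tri a b q : ball (ratr q : R) (n.+1%:R^-1) b ->
      `|ratr q - a| < n.+1%:R^-1 -> ball (a : R) e b.
    rewrite /ball/= => H1 H2.
    rewrite -(subrKA (ratr q)) (le_lt_trans (ler_normD _ _))//.
    by rewrite (distrC a) (splitr e) ltrD// (lt_trans _ ne).
  split; first split; apply: tri; eassumption.
apply: countable_bigcupT_measurable => // p.
by rewrite /V; case: ifP.
Qed.

Lemma continuous_measurable_fun3 (f : (R * R * R)%type -> R) :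
  continuous f -> measurable_fun [set: R3 R] f.
Proof.
move=> /continuousP cf; apply: (measurability _ (RGenOpens.measurableE R)).
move=> _ [_ [a [b ->] <-]]; rewrite setTI; apply: open_measurable3.
exact/cf/interval_open.
Qed.

End Measurable3.

Section Tensor.
Context d1 d2 (T1 : measurableType d1) (T2 : measurableType d2) (R : realType).
Variable m1 : {sigma_finite_measure set T1 -> \bar R}.
Variable m2 : {sigma_finite_measure set T2 -> \bar R}.
Variables (f : T1 -> R) (g : T2 -> R).
Hypothesis intf : m1.-integrable setT (EFin \o f).
Hypothesis intg : m2.-integrable setT (EFin \o g).

Let mf : measurable_fun setT f.
Proof. by have /integrableP[/measurable_EFinP] := intf. Qed.
Let mg : measurable_fun setT g.
Proof. by have /integrableP[/measurable_EFinP] := intg. Qed.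

Lemma integrable_tensor :
  (m1 \x m2)%E.-integrable setT (fun x => (f x.1 * g x.2)%:E).
Proof.
have mfg : measurable_fun setT (fun x : T1 * T2 => (f x.1 * g x.2)%:E).
  apply/measurable_EFinP; apply: measurable_funM.
    exact: (measurableT_comp mf measurable_fst).
  exact: (measurableT_comp mg measurable_snd).
apply/integrable12ltyP => //=.
under eq_integral => x _.
  under eq_integral do rewrite normrM EFinM.
  rewrite ge0_integralZl_EFin//; last by apply/measurable_EFinP; exact: measurableT_comp.
  rewrite muleC.
  over.
have /integrableP[_ fi] := intf.
have /integrableP[_ gi] := intg.
rewrite ge0_integralZl//.
- by rewrite lte_mul_pinfty ?integral_ge0// ge0_fin_numE ?integral_ge0.
- by apply/measurable_EFinP; exact: measurableT_comp.
- exact: integral_ge0.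
Qed.

Lemma Rintegral_tensor :
  \int[(m1 \x m2)%E]_x (f x.1 * g x.2) = (\int[m1]_x f x) * (\int[m2]_x g x).
Proof.
rewrite /Rintegral -integral12_prod_meas1; last exact: integrable_tensor.
rewrite /fubini_F/=.
under eq_integral => x _.
  under eq_integral do rewrite EFinM.
  rewrite integralZl//.
  rewrite -(fineK (integrable_fin_num measurableT intg)) muleC.
  over.
rewrite integralZl//.
rewrite -(fineK (integrable_fin_num measurableT intf)) -EFinM /=.
by rewrite mulrC.
Qed.

End Tensor.

Section SigmaFiniteProduct.
Context d1 d2 (T1 : measurableType d1) (T2 : measurableType d2) (R : realType).
Variable m1 : {sigma_finite_measure set T1 -> \bar R}.
Variable m2 : {sigma_finite_measure set T2 -> \bar R}.

(** A name for the product measure that carries its sigma-finite structure, as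
    the iteration of Fubini's theorem on R^3 x R^3 requires.  It is convertible
    to the product measure, so that results transfer by conversion. *)
Definition prod_sf : set (T1 * T2) -> \bar R := (m1 \x m2)%E.

HB.instance Definition _ := Measure.on prod_sf.

Lemma sigma_finite_prod : sigma_finite [set: T1 * T2] prod_sf.
Proof.
have /sigma_finiteP[A [AT ndA Afin]] := sigma_finiteT m1.
have /sigma_finiteP[B [BT ndB Bfin]] := sigma_finiteT m2.
exists (fun n => A n `*` B n) => [|n].
  apply/seteqP; split => // -[x y] _.
  have [i _ Ax] : (\bigcup_i A i) x by rewrite -AT.
  have [j _ By] : (\bigcup_i B i) y by rewrite -BT.
  exists (maxn i j) => //; split => /=.
    by move: Ax; apply/subsetPset/ndA/leq_maxl.
  by move: By; apply/subsetPset/ndB/leq_maxr.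
have [mA Aoo] := Afin n; have [mB Boo] := Bfin n.
split; first exact: measurableX.
by rewrite [ltLHS]product_measure1E// lte_mul_pinfty// ge0_fin_numE.
Qed.

HB.instance Definition _ := Measure_isSigmaFinite.Build _ _ _ prod_sf
  sigma_finite_prod.

End SigmaFiniteProduct.

Section SigmaFinite.
Variable R : realType.

Definition lebesgue2_sf :
    {sigma_finite_measure set (measurableTypeR R * measurableTypeR R)%type -> \bar R} :=
  prod_sf (@lebesgue_measure R) (@lebesgue_measure R).

Definition lebesgue3_sf : {sigma_finite_measure set R3 R -> \bar R} :=
  prod_sf lebesgue2_sf (@lebesgue_measure R).

End SigmaFinite.

Section Tensor3.
Variable R : realType.
Local Notation mu := (@lebesgue_measure R).
Variables f g h : R -> R.
Hypothesis intf : mu.-integrable setT (EFin \o f).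
Hypothesis intg : mu.-integrable setT (EFin \o g).
Hypothesis inth : mu.-integrable setT (EFin \o h).

Lemma integrable_tensor3 :
  (lebesgue3 R).-integrable setT (fun x => (f x.1.1 * g x.1.2 * h x.2)%:E).
Proof.
have intfg := integrable_tensor intf intg.
exact: (@integrable_tensor _ _ _ _ R (lebesgue2_sf R) (@lebesgue_measure R)
  (fun x => f x.1 * g x.2) h intfg inth).
Qed.

Lemma Rintegral_tensor3 :
  \int[lebesgue3 R]_x (f x.1.1 * g x.1.2 * h x.2) =
  (\int[mu]_x f x) * (\int[mu]_x g x) * (\int[mu]_x h x).
Proof.
have intfg := integrable_tensor intf intg.
have -> : \int[lebesgue3 R]_x (f x.1.1 * g x.1.2 * h x.2) = _ :=
  (@Rintegral_tensor _ _ _ _ R (lebesgue2_sf R) (@lebesgue_measure R)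
  (fun x => f x.1 * g x.2) h intfg inth).
by have -> : \int[lebesgue2_sf R]_x (f x.1 * g x.2) = _ := Rintegral_tensor intf intg.
Qed.

End Tensor3.

(** * The multiplication formula *)

Section Kernel.
Context d1 d2 (T1 : measurableType d1) (T2 : measurableType d2) (R : realType).
Variable m1 : {sigma_finite_measure set T1 -> \bar R}.
Variable m2 : {sigma_finite_measure set T2 -> \bar R}.
Variables (f : T1 -> R) (g : T2 -> R) (k : T1 * T2 -> R).
Hypothesis intf : m1.-integrable setT (fun x => (f x)%:E).
Hypothesis intg : m2.-integrable setT (fun x => (g x)%:E).
Hypothesis mk : measurable_fun setT k.
Hypothesis k1 : forall z, `|k z| <= 1.

Let H z := k z * (f z.1 * g z.2).

Let intH : (m1 \x m2)%E.-integrable setT (fun z => (H z)%:E).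
Proof. by apply: (@integrable_mulb _ _ _ _ _ _ 1) => //; exact: integrable_tensor. Qed.

Let intk1 x : m2.-integrable setT (fun y => (k (x, y) * g y)%:E).
Proof.
apply: (@integrable_mulb _ _ _ _ _ _ 1) => //.
exact: (measurableT_comp mk (pair1_measurable x)).
Qed.

Let intk2 y : m1.-integrable setT (fun x => (k (x, y) * f x)%:E).
Proof.
apply: (@integrable_mulb _ _ _ _ _ _ 1) => //.
exact: (measurableT_comp mk (pair2_measurable y)).
Qed.

Let FE x : fubini_F m2 (fun z => (H z)%:E) x =
  (f x * \int[m2]_y (k (x, y) * g y))%:E.
Proof.
rewrite /fubini_F /H/= EFinM EFin_Rintegral// -integralZl//.
by apply: eq_integral => y _; rewrite -EFinM; congr EFin; ring.
Qed.

Let GE y : fubini_G m1 (fun z => (H z)%:E) y =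
  (g y * \int[m1]_x (k (x, y) * f x))%:E.
Proof.
rewrite /fubini_G /H/= EFinM EFin_Rintegral// -integralZl//.
by apply: eq_integral => x _; rewrite -EFinM; congr EFin; ring.
Qed.

(** Fubini's theorem for k(x, y) f(x) g(y).  With the cosine and the sine of
    x . y for k this is the multiplication formula for Fourier transforms. *)
Lemma integrable_kernel :
  m1.-integrable setT (fun x => (f x * \int[m2]_y (k (x, y) * g y))%:E).
Proof.
have -> : (fun x => (f x * \int[m2]_y (k (x, y) * g y))%:E) =
  fubini_F m2 (fun z => (H z)%:E) by apply/funext => x; rewrite FE.
exact: integrable_fubini_F.
Qed.

Lemma Rintegral_kernel : \int[m1]_x (f x * \int[m2]_y (k (x, y) * g y)) =
  \int[m2]_y (g y * \int[m1]_x (k (x, y) * f x)).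
Proof.
rewrite /Rintegral; congr fine.
under eq_integral do rewrite -FE.
under [RHS]eq_integral do rewrite -GE.
by rewrite integral12_prod_meas1// integral21_prod_meas1.
Qed.

End Kernel.

Section Complex.
Variable R : realType.
Implicit Types (z w : R[i]) (t : R) (x xi : R3 R).
Local Open Scope complex_scope.

Lemma cReM z w : complex.Re (z * w) =
  complex.Re z * complex.Re w - complex.Im z * complex.Im w.
Proof. by case: z; case: w. Qed.

Lemma cImM z w : complex.Im (z * w) =
  complex.Re z * complex.Im w + complex.Im z * complex.Re w.
Proof. by case: z => a b; case: w => e f. Qed.

Lemma cReD z w : complex.Re (z + w) = complex.Re z + complex.Re w.
Proof. by case: z; case: w. Qed.

Lemma cImD z w : complex.Im (z + w) = complex.Im z + complex.Im w.
Proof. by case: z => a b; case: w => e f. Qed.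

Lemma norm_Re_le z : `|complex.Re z| <= normc z.
Proof.
case: z => a b /=; rewrite -sqrtr_sqr ler_wsqrtr// lerDl sqr_ge0//.
Qed.

Lemma norm_Im_le z : `|complex.Im z| <= normc z.
Proof.
case: z => a b /=; rewrite -sqrtr_sqr ler_wsqrtr// lerDr sqr_ge0//.
Qed.

Lemma normc_le z : normc z <= `|complex.Re z| + `|complex.Im z|.
Proof.
case: z => a b /=; rewrite -[leRHS]ger0_norm ?addr_ge0// -sqrtr_sqr ler_wsqrtr//.
rewrite sqrrD !real_normK ?num_real// lerD2r lerDl mulrn_wge0// mulr_ge0//.
Qed.

Lemma normc_ge0 z : 0 <= normc z.
Proof. by case: z => a b; exact: sqrtr_ge0. Qed.

Lemma normc_real (a : R) : normc a%:C = `|a|.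
Proof. by rewrite /= expr0n addr0 sqrtr_sqr. Qed.

Lemma measurable_x1 : measurable_fun setT (fun x : R3 R => x.1.1 : R).
Proof. exact: (measurableT_comp measurable_fst measurable_fst). Qed.

Lemma measurable_x2 : measurable_fun setT (fun x : R3 R => x.1.2 : R).
Proof. exact: (measurableT_comp measurable_snd measurable_fst). Qed.

Lemma measurable_x3 : measurable_fun setT (fun x : R3 R => x.2 : R).
Proof. exact: measurable_snd. Qed.

Lemma measurable_dot d (T : measurableType d) (f g : T -> R3 R) :
  measurable_fun setT f -> measurable_fun setT g ->
  measurable_fun setT (fun u => dot (f u) (g u)).
Proof.
move=> mf mg; rewrite /dot.
have m1 (h : T -> R3 R) : measurable_fun setT h -> measurable_fun setT (fun u => (h u).1.1).
  by move=> mh; exact: (measurableT_comp measurable_x1 mh).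
have m2 (h : T -> R3 R) : measurable_fun setT h -> measurable_fun setT (fun u => (h u).1.2).
  by move=> mh; exact: (measurableT_comp measurable_x2 mh).
have m3 (h : T -> R3 R) : measurable_fun setT h -> measurable_fun setT (fun u => (h u).2).
  by move=> mh; exact: (measurableT_comp measurable_x3 mh).
apply: measurable_funD; first apply: measurable_funD.
- by apply: measurable_funM; exact: m1.
- by apply: measurable_funM; exact: m2.
- by apply: measurable_funM; exact: m3.
Qed.

Lemma dotC x xi : dot x xi = dot xi x.
Proof. by rewrite /dot; ring. Qed.

End Complex.

Section FourierPair.
Variable R : realType.
Local Open Scope complex_scope.
Local Notation mu3 := (lebesgue3 R).
Implicit Types (G h : R3 R -> R) (phi : R3 R -> R[i]).

(** G is integrable and its Fourier transform is the real function h.  The two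
    integrals are the real part and, up to sign, the imaginary part, so that
    the relation is preserved by real linear combinations. *)
Definition fourier_pair G h : Prop :=
  mu3.-integrable setT (fun x => (G x)%:E) /\
  forall xi, \int[mu3]_x (cos (dot x xi) * G x) = h xi /\
             \int[mu3]_x (sin (dot x xi) * G x) = 0.

Lemma integrable_cos_dot G xi : mu3.-integrable setT (fun x => (G x)%:E) ->
  mu3.-integrable setT (fun x => (cos (dot x xi) * G x)%:E).
Proof.
move=> intG; apply: (@integrable_mulb _ _ _ _ _ _ 1) => //.
  by apply: measurable_cosT; exact: measurable_dot.
by move=> x; exact: cos_max.
Qed.

Lemma integrable_sin_dot G xi : mu3.-integrable setT (fun x => (G x)%:E) ->
  mu3.-integrable setT (fun x => (sin (dot x xi) * G x)%:E).
Proof.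
move=> intG; apply: (@integrable_mulb _ _ _ _ _ _ 1) => //.
  by apply: measurable_sinT; exact: measurable_dot.
by move=> x; exact: sin_max.
Qed.

Lemma fourier_pairZ (a : R) G h : fourier_pair G h ->
  fourier_pair (fun x => a * G x) (fun x => a * h x).
Proof.
move=> [intG Gh]; split; first exact: integrable_scale.
move=> xi; have [Gc Gs] := Gh xi; split.
- rewrite -Gc -RintegralZl//; last exact: integrable_cos_dot.
  by apply: eq_Rintegral => x _; ring.
- rewrite -[RHS](mulr0 a) -Gs -RintegralZl//; last exact: integrable_sin_dot.
  by apply: eq_Rintegral => x _; ring.
Qed.

Lemma fourier_pairB G1 h1 G2 h2 : fourier_pair G1 h1 -> fourier_pair G2 h2 ->
  fourier_pair (fun x => G1 x - G2 x) (fun x => h1 x - h2 x).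
Proof.
move=> [int1 Gh1] [int2 Gh2]; split; first exact: integrable_sub.
move=> xi; have [Gc1 Gs1] := Gh1 xi; have [Gc2 Gs2] := Gh2 xi; split.
- rewrite -Gc1 -Gc2 -RintegralB//; last 2 first.
    exact: integrable_cos_dot. exact: integrable_cos_dot.
  by apply: eq_Rintegral => x _; ring.
- rewrite -[RHS](subrr 0) -[in X in X - _]Gs1 -Gs2 -RintegralB//; last 2 first.
    exact: integrable_sin_dot. exact: integrable_sin_dot.
  by apply: eq_Rintegral => x _; ring.
Qed.

Lemma fourier_pair_ifourier G h : fourier_pair G h ->
  ifourier (fun x => (G x)%:C) = (fun xi => (h xi)%:C).
Proof.
move=> [intG Gh]; apply/funext => xi; have [Gc Gs] := Gh xi.
rewrite /ifourier /cintegral; congr (_ +i* _).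
- rewrite -Gc; apply: eq_Rintegral => x _.
  by rewrite cReM/= dotC mulr0 subr0.
- rewrite -[RHS]Gs.
  by apply: eq_Rintegral => x _; rewrite cImM/= dotC mulr0 add0r.
Qed.

End FourierPair.

Section Gauss3.
Variable R : realType.
Local Notation mu := (@lebesgue_measure R).
Local Notation mu3 := (lebesgue3 R).
Implicit Types (c : R) (x xi : R3 R).

Definition gauss3 (c1 c2 c3 : R) x : R :=
  gauss c1 x.1.1 * gauss c2 x.1.2 * gauss c3 x.2.

Definition gauss3_mass (c1 c2 c3 : R) : R :=
  Num.sqrt (2 * pi / c1) * Num.sqrt (2 * pi / c2) * Num.sqrt (2 * pi / c3).

Lemma gauss3_ge0 c1 c2 c3 x : 0 <= gauss3 c1 c2 c3 x.
Proof. by rewrite !mulr_ge0// gauss_ge0. Qed.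

Section pos.
Variables c1 c2 c3 : R.
Hypotheses (c1_gt0 : 0 < c1) (c2_gt0 : 0 < c2) (c3_gt0 : 0 < c3).

Lemma integrable_gauss3 : mu3.-integrable setT (fun x => (gauss3 c1 c2 c3 x)%:E).
Proof. by apply: integrable_tensor3; exact: integrable_gauss. Qed.

Lemma Rintegral_gauss3 : \int[mu3]_x gauss3 c1 c2 c3 x = gauss3_mass c1 c2 c3.
Proof.
rewrite Rintegral_tensor3; [|exact: integrable_gauss..].
by rewrite /Rintegral !integral_gauss.
Qed.

(** Expanding the cosine and the sine of a sum of three terms gives products
    of one-dimensional transforms, and those with a sine factor vanish. *)
Lemma fourier_gauss3 : fourier_pair (gauss3 c1 c2 c3)
  (fun xi => gauss3_mass c1 c2 c3 * gauss3 c1^-1 c2^-1 c3^-1 xi).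
Proof.
split; first exact: integrable_gauss3.
move=> xi.
pose C c (t : R) (y : R) := cos (t * y) * gauss c y.
pose S c (t : R) (y : R) := sin (t * y) * gauss c y.
have iC c t : 0 < c -> mu.-integrable setT (EFin \o C c t).
  move=> c0; have := integrable_cos_gauss 0 t c0; congr integrable.
  by apply/funext => y; rewrite addr0.
have iS c t : 0 < c -> mu.-integrable setT (EFin \o S c t).
  move=> c0; apply: (@integrable_bounded_gauss _ c _ 1 0) => //.
    by apply: measurable_sinT; exact: measurable_funM.
  by move=> x; rewrite mul0r addr0 sin_max.
have intC c t : 0 < c -> \int[mu]_y C c t y = Num.sqrt (2 * pi / c) * gauss c^-1 t.
  move=> c0; have := gauss_cosE 0 t c0; rewrite cos0 mul1r => <-.
  by apply: eq_Rintegral => y _; rewrite addr0.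
have intS c t : 0 < c -> \int[mu]_y S c t y = 0 by exact: gauss_sinE.
split.
- transitivity (\int[mu3]_x (C c1 xi.1.1 x.1.1 * C c2 xi.1.2 x.1.2 * C c3 xi.2 x.2
    - S c1 xi.1.1 x.1.1 * S c2 xi.1.2 x.1.2 * C c3 xi.2 x.2
    - S c1 xi.1.1 x.1.1 * C c2 xi.1.2 x.1.2 * S c3 xi.2 x.2
    - C c1 xi.1.1 x.1.1 * S c2 xi.1.2 x.1.2 * S c3 xi.2 x.2)).
    apply: eq_Rintegral => x _; rewrite /dot /gauss3 /C /S !cosD !sinD.
    rewrite !(mulrC xi.1.1) !(mulrC xi.1.2) !(mulrC xi.2); ring.
  rewrite !RintegralB//;
    try by repeat first [exact: iC|exact: iS|apply: integrable_tensor3|apply: integrable_sub].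
  rewrite !Rintegral_tensor3; try exact: iC; try exact: iS.
  rewrite !intS// !intC// !(mul0r, mulr0, subr0) /gauss3_mass /gauss3; ring.
- transitivity (\int[mu3]_x (S c1 xi.1.1 x.1.1 * C c2 xi.1.2 x.1.2 * C c3 xi.2 x.2
    + C c1 xi.1.1 x.1.1 * S c2 xi.1.2 x.1.2 * C c3 xi.2 x.2
    + C c1 xi.1.1 x.1.1 * C c2 xi.1.2 x.1.2 * S c3 xi.2 x.2
    - S c1 xi.1.1 x.1.1 * S c2 xi.1.2 x.1.2 * S c3 xi.2 x.2)).
    apply: eq_Rintegral => x _; rewrite /dot /gauss3 /C /S !sinD !cosD.
    rewrite !(mulrC xi.1.1) !(mulrC xi.1.2) !(mulrC xi.2); ring.
  rewrite RintegralB// ?RintegralD//;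
    try by repeat first [exact: iC|exact: iS|apply: integrable_tensor3|apply: integrable_add].
  rewrite !Rintegral_tensor3; try exact: iC; try exact: iS.
  by rewrite !intS// !(mul0r, mulr0, subr0) !addr0.
Qed.

End pos.
End Gauss3.

(** * Schwartz functions *)

Section Bounds.
Variable R : realType.
Implicit Types (r m : R).

Lemma exprn_le_expR n r : 0 <= r -> r ^+ n <= n`!%:R * expR r.
Proof.
move=> r0; case: n => [|n]; first by rewrite expr0 fact0 mul1r -expR0 ler_expR.
rewrite mulrC -ler_pdivrMr ?ltr0n ?fact_gt0//.
by apply: le_trans (expR_ge1Dxn n r0); rewrite lerDr.
Qed.

Lemma poly_gauss_bound n m : 0 < m ->
  exists K, 0 <= K /\ forall r, 0 <= r -> (1 + r) ^+ n * gauss m r <= K.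
Proof.
move=> m0; exists (n`!%:R * expR (1 + 1 / (2 * m))).
split; first by rewrite mulr_ge0// expR_ge0.
move=> r r0; rewrite /gauss expRN ler_pdivrMr ?expR_gt0//.
rewrite -[leRHS]mulrA -expRD.
apply: le_trans (exprn_le_expR n _) _; first by rewrite addr_ge0.
rewrite ler_pM2l ?ltr0n ?fact_gt0// ler_expR.
rewrite -addrA lerD2l.
have -> : 1 / (2 * m) + m * r ^+ 2 / 2 = (1 + m ^+ 2 * r ^+ 2) / (2 * m).
  by field; rewrite gt_eqF.
rewrite ler_pdivlMr ?mulr_gt0//.
have : 0 <= (m * r - 1) ^+ 2 by exact: sqr_ge0.
nra.
Qed.

End Bounds.

Section Pol.
Variable R : realType.
Implicit Types (f g : R3 R -> R) (x : R3 R).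

(** The polynomials on R^3, presented by their closure properties: all that is
    used is that they are stable under derivatives and grow polynomially. *)
Inductive pol : (R3 R -> R) -> Prop :=
| pol_cst a : pol (fun=> a)
| pol_x1 : pol (fun x => x.1.1)
| pol_x2 : pol (fun x => x.1.2)
| pol_x3 : pol (fun x => x.2)
| pol_D f g : pol f -> pol g -> pol (fun x => f x + g x)
| pol_M f g : pol f -> pol g -> pol (fun x => f x * g x).

Lemma is_diff_linear (f : (R * R * R)%type -> R) x :
  linear f -> continuous f -> is_diff (x : (R * R * R)%type) f f.
Proof.
move=> flin cf.
pose Lf := GRing.isLinear.Build _ _ _ _ f flin.
pose F : {linear (R * R * R)%type -> R} := HB.pack f Lf.
apply: DiffDef; first exact: (@linear_differentiable _ _ _ F).
by rewrite (@diff_lin _ _ _ F).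
Qed.

Lemma is_diff_x1 x : is_diff x (fun y : R3 R => y.1.1 : R) (fun y => y.1.1).
Proof.
apply: is_diff_linear => // y.
by apply: (@cvg_comp _ _ _ fst fst); exact: cvg_fst.
Qed.

Lemma is_diff_x2 x : is_diff x (fun y : R3 R => y.1.2 : R) (fun y => y.1.2).
Proof.
apply: is_diff_linear => // y.
by apply: (@cvg_comp _ _ _ fst snd); [exact: cvg_fst|exact: cvg_snd].
Qed.

Lemma is_diff_x3 x : is_diff x (fun y : R3 R => y.2 : R) (fun y => y.2).
Proof. by apply: is_diff_linear => // y; exact: cvg_snd. Qed.

Lemma pol_differentiable f : pol f -> forall x, differentiable f x.
Proof.
elim=> {f} [a|||| f g _ IHf _ IHg|f g _ IHf _ IHg] x.
- exact: differentiable_cst.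
- by have h := is_diff_x1 x; exact: ex_diff.
- by have h := is_diff_x2 x; exact: ex_diff.
- by have h := is_diff_x3 x; exact: ex_diff.
- exact: differentiableD.
- exact: differentiableM.
Qed.

Lemma pol_derive f v : pol f -> pol (fun x => 'D_v f x).
Proof.
elim=> {f} [a|||| f g pf IHf pg IHg|f g pf IHf pg IHg].
- have -> : (fun x => 'D_v (fun=> a) x) = (fun=> 0); last exact: pol_cst.
  by apply/funext => x; exact: derive_cst.
- have -> : (fun x => 'D_v (fun x : R3 R => x.1.1) x) = (fun=> v.1.1); last exact: pol_cst.
  apply/funext => x; have h := is_diff_x1 x; rewrite deriveE; last exact: ex_diff.
  by rewrite diff_val.
- have -> : (fun x => 'D_v (fun x : R3 R => x.1.2) x) = (fun=> v.1.2); last exact: pol_cst.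
  apply/funext => x; have h := is_diff_x2 x; rewrite deriveE; last exact: ex_diff.
  by rewrite diff_val.
- have -> : (fun x => 'D_v (fun x : R3 R => x.2) x) = (fun=> v.2); last exact: pol_cst.
  apply/funext => x; have h := is_diff_x3 x; rewrite deriveE; last exact: ex_diff.
  by rewrite diff_val.
- have -> : (fun x => 'D_v (fun x : R3 R => f x + g x) x) = (fun x => 'D_v f x + 'D_v g x).
    by apply/funext => x; apply: deriveD; apply: diff_derivable; exact: pol_differentiable.
  exact: pol_D.
- have -> : (fun x => 'D_v (fun x : R3 R => f x * g x) x) =
     (fun x => f x * 'D_v g x + g x * 'D_v f x).
    by apply/funext => x; apply: deriveM; apply: diff_derivable; exact: pol_differentiable.
  by apply: pol_D; exact: pol_M.
Qed.

Lemma enorm_ge0 x : 0 <= enorm x. Proof. exact: sqrtr_ge0. Qed.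

Lemma dotxxE x : dot x x = x.1.1 ^+ 2 + x.1.2 ^+ 2 + x.2 ^+ 2.
Proof. by rewrite /dot !expr2. Qed.

Lemma enorm_sqr x : enorm x ^+ 2 = x.1.1 ^+ 2 + x.1.2 ^+ 2 + x.2 ^+ 2.
Proof. by rewrite -dotxxE sqr_sqrtr// dotxxE !addr_ge0// sqr_ge0. Qed.

Lemma norm_x1_le x : `|x.1.1| <= enorm x.
Proof.
rewrite -sqrtr_sqr ler_wsqrtr// dotxxE -addrA lerDl addr_ge0// sqr_ge0//.
Qed.

Lemma norm_x2_le x : `|x.1.2| <= enorm x.
Proof.
rewrite -sqrtr_sqr ler_wsqrtr// dotxxE addrAC lerDr addr_ge0// sqr_ge0//.
Qed.

Lemma norm_x3_le x : `|x.2| <= enorm x.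
Proof.
rewrite -sqrtr_sqr ler_wsqrtr// dotxxE lerDr addr_ge0// sqr_ge0//.
Qed.

Lemma pol_bound f : pol f -> exists (n : nat) (C : R), 0 <= C /\
  forall x, `|f x| <= C * (1 + enorm x) ^+ n.
Proof.
have e1 x : 1 <= 1 + enorm x by rewrite lerDl enorm_ge0.
have e0 x : 0 <= 1 + enorm x by rewrite addr_ge0// enorm_ge0.
elim=> {f} [a|||| f g _ [n [C [C0 fC]]] _ [m [K [K0 gK]]]|
                  f g _ [n [C [C0 fC]]] _ [m [K [K0 gK]]]].
- by exists 0%N, `|a|; split => // x; rewrite expr0 mulr1.
- by exists 1%N, 1; split => // x; rewrite mul1r expr1 (le_trans (norm_x1_le x))// lerDr.
- by exists 1%N, 1; split => // x; rewrite mul1r expr1 (le_trans (norm_x2_le x))// lerDr.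
- by exists 1%N, 1; split => // x; rewrite mul1r expr1 (le_trans (norm_x3_le x))// lerDr.
- exists (n + m)%N, (C + K); split; first exact: addr_ge0.
  move=> x; rewrite (le_trans (ler_normD _ _))// mulrDl lerD//.
    rewrite (le_trans (fC x))// ler_wpM2l// exprD ler_peMr ?exprn_ge0// exprn_ege1//.
  rewrite (le_trans (gK x))// ler_wpM2l// exprD ler_peMl ?exprn_ge0// exprn_ege1//.
- exists (n + m)%N, (C * K); split; first exact: mulr_ge0.
  by move=> x; rewrite normrM exprD mulrACA ler_pM.
Qed.

End Pol.

Section GaussSchwartz.
Variable R : realType.
Variables c1 c2 c3 : R.
Hypotheses (c1_gt0 : 0 < c1) (c2_gt0 : 0 < c2) (c3_gt0 : 0 < c3).
Local Open Scope complex_scope.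

Let Q (x : R3 R) : R := - (c1 / 2) * (x.1.1 * x.1.1) + - (c2 / 2) * (x.1.2 * x.1.2)
  + - (c3 / 2) * (x.2 * x.2).

Let polQ : pol Q.
Proof.
by rewrite /Q; repeat first [exact: pol_cst|exact: pol_x1|exact: pol_x2|exact: pol_x3
  |apply: pol_D|apply: pol_M].
Qed.

Let gQ x : gauss3 c1 c2 c3 x = expR (Q x).
Proof. by rewrite /gauss3 /gauss /Q -!expRD; congr expR; field. Qed.

Let dQ x : differentiable (fun y => expR (Q y)) x.
Proof.
apply: (@differentiable_comp _ _ _ _ Q expR); first exact: pol_differentiable.
exact/derivable1_diffP/derivable_expR.
Qed.

Let DQ x v : 'D_v (fun y => expR (Q y)) x = 'D_v Q x * expR (Q x).
Proof.
rewrite deriveE; last exact: dQ.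
have dQx : differentiable Q x by exact: pol_differentiable.
have dE : differentiable expR (Q x) by exact/derivable1_diffP/derivable_expR.
rewrite -[fun y => _]/(expR \o Q) (diff_comp dQx dE)/= diff1E//.
have -> : expR^`()%classic (Q x) = expR (Q x) by rewrite derive1E; exact: derive_val.
by rewrite deriveE.
Qed.

(** Differentiating P e^Q, for polynomials P and Q, gives (P Q' + P') e^Q. *)
Lemma partial_gauss3 w : exists2 P, pol P &
  partial w (gauss3 c1 c2 c3) = (fun x => P x * expR (Q x)).
Proof.
elim: w => [|j w [P pP IH]].
  by exists (fun=> 1); [exact: pol_cst|apply/funext => x; rewrite mul1r -gQ].
exists (fun x => P x * 'D_(basis3 R j) Q x + 'D_(basis3 R j) P x).
  by apply: pol_D; [apply: pol_M => //|]; exact: pol_derive.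
rewrite /partial/= -/(partial w _) IH; apply/funext => x.
have dP : differentiable P x by exact: pol_differentiable.
have -> : 'D_(basis3 R j) (fun x => P x * expR (Q x)) x =
   P x * 'D_(basis3 R j) (fun y => expR (Q y)) x + expR (Q x) * 'D_(basis3 R j) P x.
  by apply: deriveM; apply: diff_derivable.
by rewrite DQ; ring.
Qed.

Lemma partial0 w : partial w (fun=> 0 : R) = (fun=> 0).
Proof.
elim: w => [//|j w IH]; rewrite /partial/= -/(partial w _) IH.
by apply/funext => x; exact: derive_cst.
Qed.

(** By [partial_gauss3] only the decay of a polynomial times a Gaussian is at
    stake, and the Gaussian is at most e^(-m |x|^2/2) for the smallest
    coefficient m. *)
Lemma schwartz_gauss3 : schwartz (fun x => (gauss3 c1 c2 c3 x)%:C).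
Proof.
split.
  move=> w x /=; split; last by rewrite partial0; exact: differentiable_cst.
  have [P pP ->] := partial_gauss3 w.
  by apply: differentiableM; [exact: pol_differentiable|exact: dQ].
move=> w N.
have [P pP PE] := partial_gauss3 w.
have [n [C [C0 PC]]] := pol_bound pP.
pose m := Num.min c1 (Num.min c2 c3).
have m0 : 0 < m by rewrite !lt_min c1_gt0 c2_gt0.
have [K [K0 HK]] := @poly_gauss_bound R (N + n) m m0.
exists (C * K) => x.
rewrite /cpartial/= PE partial0 expr0n addr0 sqrtr_sqr normrM (ger0_norm (expR_ge0 _)).
have QE : expR (Q x) <= gauss m (enorm x).
  rewrite /gauss ler_expR enorm_sqr /Q.
  have m1 : m <= c1 by rewrite ge_min lexx.
  have m2 : m <= c2 by rewrite !ge_min lexx orbT.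
  have m3 : m <= c3 by rewrite !ge_min lexx !orbT.
  have := ler_wpM2r (sqr_ge0 x.1.1) m1.
  have := ler_wpM2r (sqr_ge0 x.1.2) m2.
  have := ler_wpM2r (sqr_ge0 x.2) m3.
  lra.
have e0 : 0 <= 1 + enorm x by rewrite addr_ge0// enorm_ge0.
apply: (@le_trans _ _ ((1 + enorm x) ^+ N * (C * (1 + enorm x) ^+ n * gauss m (enorm x)))).
  rewrite ler_wpM2l ?exprn_ge0// ler_pM// expR_ge0//.
have -> : (1 + enorm x) ^+ N * (C * (1 + enorm x) ^+ n * gauss m (enorm x)) =
  C * ((1 + enorm x) ^+ (N + n) * gauss m (enorm x)) by rewrite exprD; ring.
by rewrite ler_wpM2l// HK// enorm_ge0.
Qed.

End GaussSchwartz.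

Section SchwartzBasic.
Variable R : realType.
Local Notation mu := (@lebesgue_measure R).
Local Open Scope complex_scope.
Variable phi : R3 R -> R[i].
Hypothesis phiS : schwartz phi.

Lemma schwartz_measurable : cmeasurable phi.
Proof.
split; apply: continuous_measurable_fun3 => x; apply: differentiable_continuous.
- exact: (phiS.1 [::] x).1.
- exact: (phiS.1 [::] x).2.
Qed.

Lemma schwartz_decay (N : nat) : exists M : R, forall x,
  (1 + enorm x) ^+ N * normc (phi x) <= M.
Proof.
have [M HM] := phiS.2 [::] N; exists M => x.
by have := HM x; rewrite /cpartial/=; case: (phi x).
Qed.

Lemma schwartz_bounded : exists M : R, forall x, normc (phi x) <= M.
Proof.
have [M HM] := schwartz_decay 0; exists M => x.
by have := HM x; rewrite expr0 mul1r.
Qed.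

End SchwartzBasic.

Section Weight.
Variable R : realType.
Local Notation mu := (@lebesgue_measure R).

Lemma integrable_oneDsqrV : mu.-integrable setT (fun x : R => (oneDsqr x)^-1%:E).
Proof.
have c : continuous (fun x : R => (oneDsqr x)^-1) by exact: continuous_oneDsqrV.
have g0 (x : R) : 0 <= (oneDsqr x)^-1 by rewrite invr_ge0 (le_trans ler01)// oneDsqr_ge1.
apply/integrableP; split.
  by apply/measurable_EFinP; exact: continuous_measurable_fun.
under eq_integral do rewrite abse_EFin ger0_norm//.
rewrite ge0_symfun_integralT//; last by move=> x; rewrite /oneDsqr/= sqrrN.
by rewrite -set_itvcy integral0y_oneDsqr -EFinM ltry.
Qed.

(** Decay of order 6 in |x| is more than the decay of order 2 in each
    coordinate that makes this weight integrable. *)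
Definition weight3 (x : R3 R) : R :=
  (oneDsqr x.1.1)^-1 * (oneDsqr x.1.2)^-1 * (oneDsqr x.2)^-1.

Lemma integrable_weight3 : (lebesgue3 R).-integrable setT (fun x => (weight3 x)%:E).
Proof.
have i := integrable_oneDsqrV.
exact: (integrable_tensor3 i i i).
Qed.

Lemma weight3_le (x : R3 R) : ((1 + enorm x) ^+ 6)^-1 <= weight3 x.
Proof.
have g0 (y : R) : 0 < oneDsqr y by rewrite (lt_le_trans ltr01)// oneDsqr_ge1.
rewrite /weight3 -!invfM lef_pV2 ?posrE ?mulr_gt0// ?exprn_gt0 ?ltr_pwDl ?enorm_ge0//.
have h (y : R) : `|y| <= enorm x -> oneDsqr y <= (1 + enorm x) ^+ 2.
  move=> yx; rewrite /oneDsqr -(real_normK (num_real y)) sqrrD expr1n mul1r.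
  have := enorm_ge0 x; have := normr_ge0 y; nra.
rewrite -[6%N]/(2 * 3)%N exprM 2!exprS expr1 mulrA.
by rewrite !ler_pM ?h ?norm_x1_le ?norm_x2_le ?norm_x3_le ?mulr_ge0// ltW.
Qed.

Variable phi : R3 R -> R[i].
Hypothesis phiS : schwartz phi.

Lemma schwartz_integrable : cintegrable phi.
Proof.
have [mR mI] := schwartz_measurable phiS.
have [M HM] := schwartz_decay phiS 6.
have b x : normc (phi x) <= M * weight3 x.
  have e0 : 0 < (1 + enorm x) ^+ 6 by rewrite exprn_gt0// ltr_pwDl// enorm_ge0.
  have M0 : 0 <= M by apply: le_trans (HM x); rewrite mulr_ge0 ?normc_ge0// ltW.
  apply: (@le_trans _ _ (M * ((1 + enorm x) ^+ 6)^-1)).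
    by rewrite ler_pdivlMr// mulrC.
  by rewrite ler_wpM2l// weight3_le.
have intw := integrable_scale M integrable_weight3.
split.
- apply: (integrable_le mR _ intw) => x.
  exact: le_trans (norm_Re_le _) (b x).
- apply: (integrable_le mI _ intw) => x.
  exact: le_trans (norm_Im_le _) (b x).
Qed.

End Weight.

(** * Functions as tempered distributions *)

Section CIntegral.
Variable R : realType.
Local Notation mu3 := (lebesgue3 R).
Local Open Scope complex_scope.
Implicit Types (f g phi : R3 R -> R[i]) (a : R[i]).

Lemma cintegrableZ a f : cintegrable f -> cintegrable (fun x => a * f x).
Proof.
move=> [fR fI]; split.
- by under eq_fun do rewrite cReM; apply: integrable_sub; exact: integrable_scale.
- by under eq_fun do rewrite cImM; apply: integrable_add; exact: integrable_scale.
Qed.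

Lemma cintegralD f g : cintegrable f -> cintegrable g ->
  cintegral (fun x => f x + g x) = cintegral f + cintegral g.
Proof.
move=> [fR fI] [gR gI]; rewrite /cintegral.
under eq_Rintegral do rewrite cReD.
under [X in _ +i* X]eq_Rintegral do rewrite cImD.
by rewrite !RintegralD.
Qed.

Lemma cintegralZ a f : cintegrable f ->
  cintegral (fun x => a * f x) = a * cintegral f.
Proof.
move=> [fR fI]; rewrite /cintegral.
under eq_Rintegral do rewrite cReM.
under [X in _ +i* X]eq_Rintegral do rewrite cImM.
rewrite RintegralB// ?RintegralD//; try exact: integrable_scale.
by rewrite !RintegralZl//; case: a.
Qed.

Lemma cintegrable_real_mul (G : R3 R -> R) phi : mu3.-integrable setT (fun x => (G x)%:E) ->
  schwartz phi -> cintegrable (fun x => (G x)%:C * phi x).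
Proof.
move=> intG phiS; have [mR mI] := schwartz_measurable phiS.
have [M HM] := schwartz_bounded phiS.
split.
- under eq_fun do rewrite cReM/= mul0r subr0 mulrC.
  apply: (integrable_mulb mR _ intG) => x; exact: le_trans (norm_Re_le _) (HM x).
- under eq_fun do rewrite cImM/= mul0r addr0 mulrC.
  apply: (integrable_mulb mI _ intG) => x; exact: le_trans (norm_Im_le _) (HM x).
Qed.

End CIntegral.

Section Regular.
Variable R : realType.
Local Notation mu3 := (lebesgue3 R).
Local Open Scope complex_scope.
Implicit Types (G h : R3 R -> R) (phi : R3 R -> R[i]).

(** Bounded by the integral of |G| times the supremum of the test function, a
    Schwartz seminorm of order 0; the real and imaginary parts are estimated
    separately, hence twice the integral. *)
Lemma tempered_regular G : mu3.-integrable setT (fun x => (G x)%:E) ->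
  tempered (regular (fun x => (G x)%:C)).
Proof.
move=> intG; split.
  move=> a phi psi phiS psiS; rewrite /regular.
  have i1 := cintegrable_real_mul intG phiS.
  have i2 := cintegrable_real_mul intG psiS.
  rewrite -(cintegralZ a i1) -(cintegralD (cintegrableZ a i1) i2).
  by congr cintegral; apply/funext => x; ring.
exists 0%N, (\int[mu3]_x `|G x| + \int[mu3]_x `|G x|) => phi M phiS HM.
have intN := integrable_norm intG.
have phiM x : normc (phi x) <= M.
  by have := HM [::] x isT; rewrite expr0 mul1r /cpartial/=; case: (phi x).
have [iR iI] := cintegrable_real_mul intG phiS.
have b (u : R3 R -> R) : mu3.-integrable setT (fun x => (u x)%:E) ->
    (forall x, `|u x| <= M * `|G x|) -> `|\int[mu3]_x u x| <= M * \int[mu3]_x `|G x|.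
  move=> iu uM; apply: le_trans (le_normr_Rintegral measurableT iu) _.
  rewrite -RintegralZl//; apply: le_Rintegral => //.
  - exact: (integrable_norm iu).
  - exact: integrable_scale.
rewrite (le_trans (normc_le _))// mulrC mulrDr lerD//; apply: b => // x.
- rewrite cReM/= mul0r subr0 normrM mulrC ler_wpM2r//.
  exact: le_trans (norm_Re_le _) (phiM x).
- rewrite cImM/= mul0r addr0 normrM mulrC ler_wpM2r//.
  exact: le_trans (norm_Im_le _) (phiM x).
Qed.

Lemma kernel3 (G g : R3 R -> R) (k : R3 R * R3 R -> R) :
  mu3.-integrable setT (fun x => (G x)%:E) ->
  mu3.-integrable setT (fun x => (g x)%:E) ->
  measurable_fun setT k -> (forall u, `|k u| <= 1) ->
  mu3.-integrable setT (fun x => (G x * \int[mu3]_y (k (x, y) * g y))%:E) /\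
  \int[mu3]_x (G x * \int[mu3]_y (k (x, y) * g y)) =
  \int[mu3]_y (g y * \int[mu3]_x (k (x, y) * G x)).
Proof.
move=> intG intg mk k1; split.
- exact: (@integrable_kernel _ _ _ _ R (lebesgue3_sf R) (lebesgue3_sf R) G g k).
- exact: (@Rintegral_kernel _ _ _ _ R (lebesgue3_sf R) (lebesgue3_sf R) G g k).
Qed.

Lemma clocally_integrable_real h : mu3.-integrable setT (fun x => (h x)%:E) ->
  clocally_integrable (fun x => (h x)%:C).
Proof.
move=> inth; split.
  by split => /=; [exact: integrable_measurable inth|exact: measurable_cst].
move=> K _; have /integrableP[_] := inth; apply: le_lt_trans.
rewrite integral_mkcond; apply: ge0_le_integralT => x; rewrite patchE; case: ifP => // _.
- by rewrite lee_fin normc_ge0.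
- by rewrite normc_real.
- exact: abse_ge0.
Qed.

(** The multiplication formula: the integral of G times the Fourier transform
    of phi is that of h times phi, by exchanging the integrals, without Fourier
    inversion. *)
Lemma is_function_fourier G h : fourier_pair G h ->
  mu3.-integrable setT (fun x => (h x)%:E) ->
  is_function (dfourier (regular (fun x => (G x)%:C))) (fun x => (h x)%:C).
Proof.
move=> [intG Gh] inth; split; first exact: clocally_integrable_real.
move=> phi phiS; split; first exact: cintegrable_real_mul.
have [pR pI] := schwartz_integrable phiS.
pose kc (u : R3 R * R3 R) := cos (dot u.2 u.1).
pose ks (u : R3 R * R3 R) := sin (dot u.2 u.1).
have md : measurable_fun setT (fun u : R3 R * R3 R => dot u.2 u.1).
  by apply: measurable_dot; [exact: measurable_snd|exact: measurable_fst].
have mkc : measurable_fun setT kc by exact: measurable_cosT.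
have mks : measurable_fun setT ks by exact: measurable_sinT.
have kc1 u : `|kc u| <= 1 by exact: cos_max.
have ks1 u : `|ks u| <= 1 by exact: sin_max.
have [icR EcR] := kernel3 intG pR mkc kc1.
have [icI EcI] := kernel3 intG pI mkc kc1.
have [isR EsR] := kernel3 intG pR mks ks1.
have [isI EsI] := kernel3 intG pI mks ks1.
have cE xi : \int[mu3]_x (kc (x, xi) * G x) = h xi.
  by have [<- _] := Gh xi; apply: eq_Rintegral => x _; rewrite /kc/= dotC.
have sE xi : \int[mu3]_x (ks (x, xi) * G x) = 0.
  by have [_ <-] := Gh xi; apply: eq_Rintegral => x _; rewrite /ks/= dotC.
have four x : fourier phi x =
   (\int[mu3]_y (kc (x, y) * complex.Re (phi y)) +
    \int[mu3]_y (ks (x, y) * complex.Im (phi y)))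
   +i* (\int[mu3]_y (kc (x, y) * complex.Im (phi y)) -
        \int[mu3]_y (ks (x, y) * complex.Re (phi y))).
  have jc (u : R3 R -> R) : mu3.-integrable setT (fun x => (u x)%:E) ->
     mu3.-integrable setT (fun y => (kc (x, y) * u y)%:E).
    exact: (@integrable_cos_dot R u x).
  have js (u : R3 R -> R) : mu3.-integrable setT (fun x => (u x)%:E) ->
     mu3.-integrable setT (fun y => (ks (x, y) * u y)%:E).
    exact: (@integrable_sin_dot R u x).
  rewrite /fourier /cintegral; congr (_ +i* _).
  - rewrite -(RintegralD measurableT (jc _ pR) (js _ pI)).
    by apply: eq_Rintegral => y _; rewrite cReM/= /kc /ks/= cosN sinN; ring.
  - rewrite -(RintegralB measurableT (jc _ pI) (js _ pR)).
    by apply: eq_Rintegral => y _; rewrite cImM/= /kc /ks/= cosN sinN; ring.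
rewrite /dfourier /regular /cintegral; congr (_ +i* _).
- transitivity (\int[mu3]_x (G x * \int[mu3]_y (kc (x, y) * complex.Re (phi y)) +
     G x * \int[mu3]_y (ks (x, y) * complex.Im (phi y)))).
    by apply: eq_Rintegral => x _; rewrite four cReM/= mul0r subr0 mulrDr.
  rewrite (RintegralD measurableT icR isI) EcR EsI [X in _ + X]Rintegral_eq0 ?addr0; last first.
    by move=> y; rewrite sE mulr0.
  by apply: eq_Rintegral => y _; rewrite cE cReM/= mul0r subr0 mulrC.
- transitivity (\int[mu3]_x (G x * \int[mu3]_y (kc (x, y) * complex.Im (phi y)) -
     G x * \int[mu3]_y (ks (x, y) * complex.Re (phi y)))).
    by apply: eq_Rintegral => x _; rewrite four cImM/= mul0r addr0 mulrBr.
  rewrite (RintegralB measurableT icI isR) EcI EsR [X in _ - X]Rintegral_eq0 ?subr0; last first.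
    by move=> y; rewrite sE mulr0.
  by apply: eq_Rintegral => y _; rewrite cE cImM/= mul0r addr0 mulrC.
Qed.

Lemma in_Hdot_regular s G h : fourier_pair G h ->
  mu3.-integrable setT (fun x => (h x)%:E) ->
  (Hdot_norm s (fun x => (h x)%:C) < +oo)%E ->
  in_Hdot s (regular (fun x => (G x)%:C)) (fun x => (h x)%:C).
Proof.
move=> Gh inth fin; split => //; first exact: tempered_regular Gh.1.
exact: is_function_fourier.
Qed.

End Regular.

(** * Lower bounds for oscillatory integrals and for L^q norms *)

Section Oscillation.
Variable R : realType.
Local Notation mu3 := (lebesgue3 R).
Local Open Scope complex_scope.

Lemma one_sub_cos_le (x : R) : 1 - cos x <= `|x|.
Proof.
wlog x0 : x / 0 <= x => [H|].
  have [/H//|x0] := lerP 0 x.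
  by have := H (- x); rewrite cosN normrN; apply; rewrite oppr_ge0 ltW.
have [c _] := @MVT_segment R cos (fun x => - sin x) 0 x x0
  (fun y _ => is_derive_cos y) (continuous_subspaceT (@continuous_cos R)).
rewrite cos0 subr0 => cE; rewrite -opprB cE mulNr opprK.
by rewrite (le_trans (ler_norm _))// normrM ler_piMl// sin_max.
Qed.

(** The left-hand side is the real part of e^(- i t0) z. *)
Lemma normc_expi_le (t0 : R) (z : R[i]) :
  cos t0 * complex.Re z + sin t0 * complex.Im z <= normc z.
Proof.
case: z => a b /=; apply: (le_trans (ler_norm _)).
rewrite -sqrtr_sqr ler_wsqrtr//.
have := cos2Dsin2 t0; set c := cos t0; set s := sin t0 => cs.
have -> : a ^+ 2 + b ^+ 2 = (c * a + s * b) ^+ 2 + (c * b - s * a) ^+ 2.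
  transitivity ((c ^+ 2 + s ^+ 2) * (a ^+ 2 + b ^+ 2)); first by rewrite cs mul1r.
  by ring.
by rewrite lerDl sqr_ge0.
Qed.

(** After multiplication by e^(- i t0) the real part of the integrand is
    cos(theta - t0) h >= (1 - |theta - t0|) h. *)
Lemma normc_oscillation (theta h e : R3 R -> R) (t0 : R) :
  measurable_fun setT theta ->
  mu3.-integrable setT (fun x => (h x)%:E) -> (forall x, 0 <= h x) ->
  mu3.-integrable setT (fun x => (e x)%:E) ->
  (forall x, `|theta x - t0| * h x <= e x) ->
  \int[mu3]_x h x - \int[mu3]_x e x <=
    normc (cintegral (fun x => expi (theta x) * (h x)%:C)).
Proof.
move=> mth ih h0 ie the; apply: le_trans (normc_expi_le t0 _).
rewrite /cintegral/=.
have ic : mu3.-integrable setT (fun x => (cos (theta x) * h x)%:E).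
  by apply: (@integrable_mulb _ _ _ _ _ _ 1) => //;
    [exact: measurable_cosT|move=> x; exact: cos_max].
have is_ : mu3.-integrable setT (fun x => (sin (theta x) * h x)%:E).
  by apply: (@integrable_mulb _ _ _ _ _ _ 1) => //;
    [exact: measurable_sinT|move=> x; exact: sin_max].
under [X in _ <= cos t0 * X + _]eq_Rintegral do rewrite mulr0 subr0.
under [X in _ <= _ + sin t0 * X]eq_Rintegral do rewrite mulr0 add0r.
rewrite -!RintegralZl// -RintegralB// -RintegralD//; try exact: integrable_scale.
apply: le_Rintegral => //.
- exact: integrable_sub.
- by apply: integrable_add; exact: integrable_scale.
move=> x _.
have -> : cos t0 * (cos (theta x) * h x) + sin t0 * (sin (theta x) * h x) =
  cos (theta x - t0) * h x by rewrite cosB; ring.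
rewrite lerBlDl -lerBlDr -[X in X - _]mul1r -mulrBl.
apply: le_trans (the x); rewrite ler_wpM2r//; exact: one_sub_cos_le.
Qed.

End Oscillation.

Section Duality.
Variable R : realType.
Local Notation mu3 := (lebesgue3 R).
Local Open Scope complex_scope.
Variables c1 c2 c3 : R.
Hypotheses (c1_gt0 : 0 < c1) (c2_gt0 : 0 < c2) (c3_gt0 : 0 < c3).
Local Notation g3 := (gauss3 c1 c2 c3).
Local Notation m3 := (gauss3_mass c1 c2 c3).

Lemma gauss3_mass_gt0 : 0 < m3.
Proof. by rewrite !mulr_gt0// sqrtr_gt0 divr_gt0// mulr_gt0// pi_gt0. Qed.

Lemma gauss3_le1 x : g3 x <= 1.
Proof.
rewrite /gauss3 !mulr_ile1// ?mulr_ge0 ?gauss_ge0//; apply: gauss_le1; exact: ltW.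
Qed.

Lemma integral_gauss3 : (\int[mu3]_x (g3 x)%:E = m3%:E)%E.
Proof.
have i := integrable_gauss3 c1_gt0 c2_gt0 c3_gt0.
by rewrite -EFin_Rintegral// Rintegral_gauss3.
Qed.

Lemma measurable_gauss3 : measurable_fun setT g3.
Proof. exact: integrable_measurable (integrable_gauss3 c1_gt0 c2_gt0 c3_gt0). Qed.

Lemma measurable_normc (f : R3 R -> R[i]) : cmeasurable f ->
  measurable_fun setT (fun x => normc (f x)).
Proof.
move=> [mR mI].
have -> : (fun x => normc (f x)) = (fun x =>
    Num.sqrt (complex.Re (f x) ^+ 2 + complex.Im (f x) ^+ 2)).
  by apply/funext => x; case: (f x).
apply: (@measurableT_comp _ _ _ _ _ _ (@Num.sqrt R)).
  by apply: continuous_measurable_fun; exact: sqrt_continuous.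
by apply: measurable_funD; exact: measurable_funX.
Qed.

Lemma lebesgue3_gt0 : (0 < mu3 setT)%E.
Proof.
rewrite lt0e measure_ge0 andbT; apply/eqP => mu0.
have := integral_gauss3; rewrite null_set_integral//; last first.
  by apply/measurable_EFinP; exact: measurable_gauss3.
by move=> [] /esym /eqP; rewrite gt_eqF// gauss3_mass_gt0.
Qed.

(** Hoelder's inequality.  Since the Gaussian is at most 1 and the conjugate
    exponent q' at least 1, its power of order q' is at most itself, so that
    its L^q' norm is at most its mass to the power 1/q' = 1 - 1/q. *)
Lemma gauss3_hoelder (q : \bar R) (f : R3 R -> R[i]) : (2%:E <= q)%E -> cmeasurable f ->
  (\int[mu3]_x (normc (f x) * g3 x)%:E <=
    Lq_norm q f * (m3 `^ (1 - fine q^-1))%:E)%E.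
Proof.
move=> q2 /measurable_normc mf.
have m0 := gauss3_mass_gt0.
case: q q2 => [r r2|_|//].
- have r2' : 2 <= r by rewrite -lee_fin.
  have r0 : 0 < r by apply: lt_le_trans r2'.
  have r1 : 1 < r by apply: lt_le_trans r2'; rewrite ltr1n.
  pose r' := (1 - r^-1)^-1.
  have rV1 : r^-1 < 1 by rewrite invf_lt1.
  have d0 : 0 < 1 - r^-1 by rewrite subr_gt0.
  have r'0 : 0 < r' by rewrite invr_gt0.
  have r'1 : 1 <= r' by rewrite invf_ge1// lerBlDr lerDl invr_ge0 ltW.
  have pq : r^-1 + r'^-1 = 1 by rewrite /r' invrK addrC subrK.
  have H := hoelder mu3 mf measurable_gauss3 r0 r'0 pq.
  have -> : (\int[mu3]_x (normc (f x) * g3 x)%:E =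
      'N[mu3]_1 [ EFin \o ((fun x => normc (f x)) \* g3)%R ])%E.
    rewrite Lnorm1; apply: eq_integral => x _.
    by rewrite /= ger0_norm// mulr_ge0 ?normc_ge0// gauss3_ge0.
  apply: (le_trans H); apply: lee_pmul; [exact: Lnorm_ge0|exact: Lnorm_ge0|by []|].
  rewrite inver gt_eqF//= unlock.
  have -> : 1 - r^-1 = r'^-1 by rewrite invrK.
  rewrite -poweR_EFin; apply: gt0_ler_poweR => //.
  + by rewrite invr_ge0 ltW.
  + by rewrite in_itv/= leey andbT integral_ge0// => x _; exact: poweR_ge0.
  + by rewrite in_itv/= leey andbT lee_fin ltW.
  rewrite -integral_gauss3; apply: ge0_le_integralT => x; first exact: poweR_ge0.
  rewrite /= lee_fin ger0_norm ?gauss3_ge0//.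
  have g0 : 0 < g3 x by rewrite !mulr_gt0 ?gauss_gt0.
  by rewrite -[leRHS]powRr1 ?gauss3_ge0// ger_powR// g0 gauss3_le1.
- rewrite invey /= subr0 powRr1 ?(ltW m0)// /Lq_norm unlock lebesgue3_gt0.
  set L := ess_sup _ _.
  have Lae : \forall x \ae mu3, (`|(normc (f x))%:E| <= L)%E.
    exact: (@ess_sup_ge _ _ _ mu3 (abse \o (fun x => (normc (f x))%:E))).
  have L0 : (0 <= L)%E.
    by apply: ess_sup_gee; [exact: lebesgue3_gt0|apply: nearW => x; exact: abse_ge0].
  rewrite -integral_gauss3 -ge0_integralZl//; last 2 first.
    by apply/measurable_EFinP; exact: measurable_gauss3.
    by move=> x _; rewrite lee_fin gauss3_ge0.
  apply: ae_ge0_le_integral => //.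
  + by move=> x _; rewrite lee_fin mulr_ge0 ?normc_ge0// gauss3_ge0.
  + apply/measurable_EFinP; apply: measurable_funM => //; exact: measurable_gauss3.
  + by move=> x _; rewrite mule_ge0// lee_fin gauss3_ge0.
  + by apply: emeasurable_funM => //; apply/measurable_EFinP; exact: measurable_gauss3.
  + apply: filterS Lae => x Lx _; rewrite EFinM lee_wpmul2r// ?lee_fin ?gauss3_ge0//.
    by move: Lx; rewrite abse_EFin ger0_norm// normc_ge0.
Qed.

(** Duality: every function f that represents T satisfies
    |T(g)| <= 2 int |f| g for the Gaussian g, the factor 2 coming from the real
    and imaginary parts, and [gauss3_hoelder] applies to f. *)
Lemma dist_Lq_norm_ge (q : \bar R) (T : (R3 R -> R[i]) -> R[i]) (A : R) :
  (2%:E <= q)%E -> A <= normc (T (fun x => (g3 x)%:C)) ->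
  ((A / (2 * m3 `^ (1 - fine (q^-1)%E)))%:E <= dist_Lq_norm q T)%E.
Proof.
move=> q2 AT.
have P0 : 0 < 2 * m3 `^ (1 - fine (q^-1)%E).
  by rewrite mulr_gt0// powR_gt0// gauss3_mass_gt0.
apply: le_ereal_inf_tmp => _ [f [[mf _] fT] <-].
have [[iR iI] TE] := fT _ (schwartz_gauss3 c1_gt0 c2_gt0 c3_gt0).
rewrite EFinM lee_pdivrMr//.
apply: (@le_trans _ _ (2%:E * \int[mu3]_x (normc (f x) * g3 x)%:E)%E); last first.
  by rewrite EFinM muleCA lee_pmul2l//; exact: gauss3_hoelder.
apply: le_trans (_ : _ <= (normc (regular f (fun x => (g3 x)%:C)))%:E)%E _.
  by rewrite lee_fin -TE.
apply: le_trans (_ : _ <= (`|\int[mu3]_x complex.Re (f x * (g3 x)%:C)|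
   + `|\int[mu3]_x complex.Im (f x * (g3 x)%:C)|)%:E)%E _.
  by rewrite lee_fin; exact: normc_le.
have b (u : R3 R -> R) : mu3.-integrable setT (fun x => (u x)%:E) ->
    (forall x, `|u x| <= normc (f x) * g3 x) ->
    (`|\int[mu3]_x u x|%:E <= \int[mu3]_x (normc (f x) * g3 x)%:E)%E.
  move=> iu ub.
  apply: le_trans (_ : _ <= (\int[mu3]_x `|u x|)%:E)%E _.
    by rewrite lee_fin le_normr_Rintegral.
  rewrite EFin_Rintegral; last exact: (integrable_norm iu).
  by apply: ge0_le_integralT => x; rewrite lee_fin.
rewrite mule_natl mule2n EFinD leeD//; apply: b => // x.
- by rewrite cReM/= mulr0 subr0 normrM (ger0_norm (gauss3_ge0 _ _ _ _))
    ler_wpM2r ?gauss3_ge0 ?norm_Re_le.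
- by rewrite cImM/= mulr0 add0r normrM (ger0_norm (gauss3_ge0 _ _ _ _))
    ler_wpM2r ?gauss3_ge0 ?norm_Im_le.
Qed.

End Duality.

(** * Wave packets *)

Section Gauss3Scaling.
Variable R : realType.
Implicit Types (a b c : R) (x xi : R3 R).

Lemma gaussM c c' (t : R) : gauss c t * gauss c' t = gauss (c + c') t.
Proof. by rewrite /gauss -expRD; congr expR; field. Qed.

Lemma gauss3M c1 c2 c3 c1' c2' c3' x :
  gauss3 c1 c2 c3 x * gauss3 c1' c2' c3' x = gauss3 (c1 + c1') (c2 + c2') (c3 + c3') x.
Proof. by rewrite /gauss3 -!gaussM; ring. Qed.

Lemma gauss3_sqr c1 c2 c3 x :
  gauss3 c1 c2 c3 x * gauss3 c1 c2 c3 x = gauss3 (2 * c1) (2 * c2) (2 * c3) x.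
Proof. by rewrite gauss3M !(mulr_natl _ 2) !mulr2n. Qed.

(** The mass of a Gaussian is inverse to that of its Fourier transform up to a
    constant.  The value of a packet's evolution on its dual Gaussian therefore
    does not depend on the scales. *)
Lemma gauss3_massM c1 c2 c3 : 0 < c1 -> 0 < c2 -> 0 < c3 ->
  gauss3_mass c1^-1 c2^-1 c3^-1 * gauss3_mass (2 * c1) (2 * c2) (2 * c3) =
  Num.sqrt (2 * pi ^+ 2) ^+ 3.
Proof.
have h c : 0 < c -> Num.sqrt (2 * pi / c^-1) * Num.sqrt (2 * pi / (2 * c)) =
    Num.sqrt (2 * pi ^+ 2).
  move=> c0; rewrite -sqrtrM; last first.
    by rewrite divr_ge0 ?mulr_ge0 ?pi_ge0 ?invr_ge0 ?ltW.
  by congr Num.sqrt; field; rewrite gt_eqF.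
move=> c10 c20 c30; rewrite /gauss3_mass !exprS expr0 mulr1.
by rewrite -{1}(h _ c10) -{1}(h _ c20) -(h _ c30); ring.
Qed.

End Gauss3Scaling.

Section Packet.
Variable R : realType.
Local Notation mu3 := (lebesgue3 R).
Local Open Scope complex_scope.
Implicit Types (a b c M : R) (x xi : R3 R).

(** A frequency profile of width a^(-1/2) in xi_1 and xi_2 and b^(-1/2) in
    xi_3 that vanishes to order 2k on the plane xi_1 = 0. *)
Definition packet (k : nat) M a b xi : R :=
  (1 - gauss (M * a) xi.1.1) ^+ k * gauss3 a a b xi.

(** Multiplying the Gaussian of coefficient c by the factor 1 - e^(-M a xi_1^2/2)
    subtracts from it the Gaussian of coefficient c + M a.  The induction on k
    therefore has to be done for all coefficients of xi_1^2. *)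
Lemma packet_fourier_pair k M a b : 0 <= M -> 0 < a -> 0 < b ->
  exists G, fourier_pair G (packet k M a b).
Proof.
move=> M0 a0 b0.
suff H c : 0 < c -> exists G, fourier_pair G
    (fun xi => (1 - gauss (M * a) xi.1.1) ^+ k * gauss3 c a b xi) by exact: H.
elim: k c => [|k IH] c c0.
- exists (fun x => (gauss3_mass c^-1 a^-1 b^-1)^-1 * gauss3 c^-1 a^-1 b^-1 x).
  have := fourier_gauss3 (c1 := c^-1) (c2 := a^-1) (c3 := b^-1).
  rewrite !invr_gt0 !invrK => /(_ c0 a0 b0).
  move=> /(fourier_pairZ (gauss3_mass c^-1 a^-1 b^-1)^-1).
  congr fourier_pair; apply/funext => xi.
  rewrite expr0 mul1r mulrA mulVf ?mul1r// gt_eqF// gauss3_mass_gt0// invr_gt0//.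
- have [G1 H1] := IH c c0.
  have cM : 0 < c + M * a by rewrite ltr_wpDr// mulr_ge0// ltW.
  have [G2 H2] := IH _ cM.
  exists (fun x => G1 x - G2 x); have := fourier_pairB H1 H2.
  congr fourier_pair; apply/funext => xi.
  by rewrite /gauss3 -gaussM exprS; ring.
Qed.

Section pos.
Variables (k : nat) (M a b : R).
Hypotheses (k_gt0 : (0 < k)%N) (M_ge0 : 0 <= M) (a_gt0 : 0 < a) (b_gt0 : 0 < b).

Let Ma_ge0 : 0 <= M * a. Proof. by rewrite mulr_ge0// ltW. Qed.

Let u_ge0 xi : 0 <= 1 - gauss (M * a) xi.1.1.
Proof. by rewrite subr_ge0 gauss_le1. Qed.

Let u_le1 xi : 1 - gauss (M * a) xi.1.1 <= 1.
Proof. by rewrite gerBl gauss_ge0. Qed.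

Lemma packet_ge0 xi : 0 <= packet k M a b xi.
Proof. by rewrite mulr_ge0 ?exprn_ge0// gauss3_ge0. Qed.

Lemma packet_le xi : packet k M a b xi <= gauss3 a a b xi.
Proof. by rewrite ler_piMl ?gauss3_ge0// exprn_ile1. Qed.

Lemma integrable_packet : mu3.-integrable setT (fun xi => (packet k M a b xi)%:E).
Proof.
apply: (@integrable_le _ _ _ _ _ (gauss3 a a b)).
- apply: measurable_funM; last exact: measurable_gauss3.
  apply: measurable_funX; apply: measurable_funB => //.
  by apply: (measurableT_comp _ (@measurable_x1 R)); exact: measurable_gauss.
- by move=> x; rewrite ger0_norm ?packet_ge0// packet_le.
- exact: integrable_gauss3.
Qed.

(** Bernoulli's inequality (1 - y)^k >= 1 - k y, which makes the lower bound a
    combination of Gaussians. *)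
Lemma packet_lower xi :
  gauss3 a a b xi - k%:R * gauss3 (a + M * a) a b xi <= packet k M a b xi.
Proof.
have bern (n : nat) (y : R) : 0 <= y <= 1 -> 1 - n%:R * y <= (1 - y) ^+ n.
  move=> /andP[y0 y1]; elim: n => [|n IH]; first by rewrite mul0r subr0 expr0.
  rewrite exprS; apply: (@le_trans _ _ ((1 - y) * (1 - n%:R * y))).
    rewrite -natr1; have : 0 <= n%:R * y * y by rewrite !mulr_ge0.
    by lra.
  by rewrite ler_wpM2l// subr_ge0.
have -> : gauss3 a a b xi - k%:R * gauss3 (a + M * a) a b xi =
  (1 - k%:R * gauss (M * a) xi.1.1) * gauss3 a a b xi.
  by rewrite /gauss3 -gaussM; ring.
by rewrite ler_wpM2r ?gauss3_ge0// bern// gauss_ge0 gauss_le1.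
Qed.

Lemma one_sub_gauss_le (c t : R) : 1 - gauss c t <= c * t ^+ 2 / 2.
Proof. by rewrite /gauss; have := expR_ge1Dx (- (c * t ^+ 2 / 2)); lra. Qed.

(** One factor 1 - e^(-v) is at most v, the k - 1 others at most 1: the packet
    vanishes at least to second order on the plane xi_1 = 0. *)
Lemma packet_upper xi :
  packet k M a b xi <= M * a / 2 * xi.1.1 ^+ 2 * gauss3 a a b xi.
Proof.
rewrite ler_wpM2r ?gauss3_ge0//.
apply: (@le_trans _ _ (1 - gauss (M * a) xi.1.1)).
  by rewrite -[leRHS]expr1 ler_wiXn2l.
by apply: le_trans (one_sub_gauss_le _ _) _; rewrite le_eqVlt; apply/orP; left; apply/eqP; ring.
Qed.

End pos.
End Packet.

Section Phase.
Variable R : realType.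
Implicit Types (F : R) (x xi : R3 R).

(** With E = |xi| and E_F = |xi|_F the difference is (E_F - E)/(F E), where
    (E_F - E)(E_F + E) = (F^2 - 1) xi_3^2 and E_F + E >= 2 E. *)
Lemma pF_stationary F xi : 1 < F ->
  `|pF F xi - F^-1| * xi.1.1 ^+ 2 <= F * xi.2 ^+ 2.
Proof.
move=> F1; have F0 : 0 < F by apply: lt_trans F1.
have [E0|E0] := eqVneq (enorm xi) 0.
  have -> : xi.1.1 = 0.
    by apply/eqP; rewrite -normr_le0 -E0; exact: norm_x1_le.
  by rewrite expr0n mulr0 mulr_ge0// ?sqr_ge0// ltW.
have Egt0 : 0 < enorm xi by rewrite lt_def E0 enorm_ge0.
set E := enorm xi in E0 Egt0 *.
have E2 : E ^+ 2 = xi.1.1 ^+ 2 + xi.1.2 ^+ 2 + xi.2 ^+ 2 by exact: enorm_sqr.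
set EF := enormF F xi.
have EF2 : EF ^+ 2 = xi.1.1 ^+ 2 + xi.1.2 ^+ 2 + F ^+ 2 * xi.2 ^+ 2.
  by rewrite /EF /enormF enorm_sqr/= exprMn.
have EEF : E <= EF.
  rewrite -(ler_pXn2r (n := 2)) ?nnegrE ?enorm_ge0// E2 EF2 lerD2l ler_peMl ?sqr_ge0//.
  by rewrite exprn_ege1// ltW.
have pE : pF F xi - F^-1 = (EF - E) / (F * E).
  by rewrite /pF -/E -/EF; field; rewrite E0 gt_eqF.
have FE0 : 0 <= F * E by rewrite ltW// mulr_gt0.
rewrite pE ger0_norm; last by rewrite divr_ge0 ?subr_ge0.
have x1E : xi.1.1 ^+ 2 <= E ^+ 2.
  by rewrite E2 -addrA lerDl addr_ge0 ?sqr_ge0.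
apply: (@le_trans _ _ ((EF - E) / (F * E) * E ^+ 2)).
  by rewrite ler_wpM2l// divr_ge0 ?subr_ge0.
have -> : (EF - E) / (F * E) * E ^+ 2 = (EF - E) * E / F.
  by field; rewrite E0 gt_eqF.
rewrite ler_pdivrMr//.
have : (EF - E) * (EF + E) = (F ^+ 2 - 1) * xi.2 ^+ 2.
  by rewrite -subr_sqr EF2 E2; ring.
have := sqr_ge0 xi.2; rewrite -subr_ge0 in EEF.
set d := EF - E in EEF *; move=> z0 dE.
have : d * (2 * E) <= d * (EF + E) by rewrite ler_wpM2l// mulr_natl mulr2n lerD2r -subr_ge0.
have : 0 <= d * E by rewrite mulr_ge0// ltW.
rewrite dE; nra.
Qed.

Lemma measurable_pF F : measurable_fun setT (fun xi : R3 R => pF F xi).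
Proof.
have ms d (T : measurableType d) (f : T -> R) : measurable_fun setT f ->
    measurable_fun setT (fun u => Num.sqrt (f u)).
  move=> mf; apply: (measurableT_comp _ mf).
  by apply: continuous_measurable_fun; exact: sqrt_continuous.
have mi d (T : measurableType d) (f : T -> R) : measurable_fun setT f ->
    (forall u, 0 <= f u) -> measurable_fun setT (fun u => (f u)^-1).
  move=> mf f0; have -> : (fun u => (f u)^-1) = (fun u => f u `^ (-1)).
    by apply/funext => u; rewrite powR_inv1.
  exact: (measurableT_comp (@measurable_powR R (-1)) mf).
have -> : (fun xi : R3 R => pF F xi) = (fun xi : R3 R =>
   F^-1 * (enormF F xi * (enorm xi)^-1)).
  by apply/funext => xi; rewrite /pF invfM; ring.
apply: measurable_funM => //; apply: measurable_funM.
- apply: ms; apply: (@measurable_dot R _ _ (fun xi : R3 R => (xi.1, F * xi.2))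
    (fun xi : R3 R => (xi.1, F * xi.2)));
  apply: measurable_fun_pair; (try exact: measurable_fst);
  by apply: measurable_funM => //; exact: measurable_snd.
- apply: mi; last by move=> x; exact: enorm_ge0.
  by apply: ms; exact: measurable_dot.
Qed.

End Phase.

(** * Evolution of a wave packet *)

Section PacketEvolution.
Variable R : realType.
Local Notation mu3 := (lebesgue3 R).
Local Open Scope complex_scope.
Variables (k : nat) (a b eps F : R) (sgn : bool).
Hypotheses (k_gt0 : (0 < k)%N) (a_gt0 : 0 < a) (b_gt0 : 0 < b).
Hypotheses (eps_gt0 : 0 < eps) (F_gt1 : 1 < F).
(** This value makes the Bernoulli correction at most half of the main term,
    see [mass_cut]. *)
Let M : R := 8 * k%:R ^+ 2.
Let N : R := gauss3_mass a^-1 a^-1 b^-1.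
Let m : R := gauss3_mass (2 * a) (2 * a) (2 * b).

Let M_ge0 : 0 <= M. Proof. by rewrite mulr_ge0// sqr_ge0. Qed.
Let aV_gt0 : 0 < a^-1. Proof. by rewrite invr_gt0. Qed.
Let bV_gt0 : 0 < b^-1. Proof. by rewrite invr_gt0. Qed.
Let a2_gt0 : 0 < 2 * a. Proof. by rewrite mulr_gt0. Qed.
Let b2_gt0 : 0 < 2 * b. Proof. by rewrite mulr_gt0. Qed.
Let aM_gt0 : 0 < 2 * a + M * a. Proof. by rewrite ltr_wpDr// mulr_ge0// ltW. Qed.
Let N_gt0 : 0 < N. Proof. exact: gauss3_mass_gt0. Qed.
Let m_gt0 : 0 < m. Proof. exact: gauss3_mass_gt0. Qed.

(** Both sides differ in the coefficient of xi_1^2 only, and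
    k^2 * 2/(2 + M) <= 1/4. *)
Let mass_cut : k%:R * gauss3_mass (2 * a + M * a) (2 * a) (2 * b) <= m / 2.
Proof.
suff h : k%:R * Num.sqrt (2 * pi / (2 * a + M * a)) <= Num.sqrt (2 * pi / (2 * a)) / 2.
  rewrite /m /gauss3_mass.
  set A := Num.sqrt (2 * pi / (2 * a + M * a)) in h *.
  set B := Num.sqrt (2 * pi / (2 * a)) in h *; set C := Num.sqrt _.
  have -> : k%:R * (A * B * C) = (k%:R * A) * (B * C) by ring.
  have -> : B * B * C / 2 = (B / 2) * (B * C) by ring.
  by rewrite ler_wpM2r// mulr_ge0// sqrtr_ge0.
have -> : k%:R * Num.sqrt (2 * pi / (2 * a + M * a)) =
    Num.sqrt (k%:R ^+ 2 * (2 * pi / (2 * a + M * a))).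
  by rewrite [RHS]sqrtrM ?sqr_ge0// sqrtr_sqr ger0_norm.
have -> : Num.sqrt (2 * pi / (2 * a)) / 2 = Num.sqrt (2 * pi / (2 * a) * (2^-1 ^+ 2)).
  by rewrite [RHS]sqrtrM ?divr_ge0 ?mulr_ge0 ?pi_ge0 ?ltW// sqrtr_sqr ger0_norm.
apply: ler_wsqrtr.
have -> : k%:R ^+ 2 * (2 * pi / (2 * a + M * a)) =
   (pi / a) * (2 * k%:R ^+ 2 / (2 + M)) :> R.
  by field; rewrite !gt_eqF//= ltr_wpDr.
have -> : 2 * pi / (2 * a) * (2^-1 ^+ 2) = (pi / a) * (1 / 4) :> R.
  by field; rewrite gt_eqF.
rewrite ler_wpM2l ?divr_ge0 ?pi_ge0 ?(ltW a_gt0)//.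
rewrite ler_pdivrMr; last by rewrite ltr_wpDr.
by rewrite /M; lra.
Qed.

Let mass_err : gauss3_mass (2 * a) (2 * a) b <= 2 * m.
Proof.
rewrite /m /gauss3_mass mulrCA.
rewrite ler_wpM2l ?mulr_ge0 ?sqrtr_ge0//.
have -> : 2 * Num.sqrt (2 * pi / (2 * b)) = Num.sqrt (2 ^+ 2 * (2 * pi / (2 * b))).
  by rewrite [RHS]sqrtrM ?sqr_ge0// sqrtr_sqr ger0_norm.
apply: ler_wsqrtr; rewrite -subr_ge0.
have -> : 2 ^+ 2 * (2 * pi / (2 * b)) - 2 * pi / b = 2 * pi / b :> R.
  by field; rewrite gt_eqF.
by rewrite divr_ge0 ?mulr_ge0 ?pi_ge0 ?(ltW b_gt0).
Qed.

(** Half of the Gaussian absorbs the factor z^2. *)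
Let sqr_gauss_le (z : R) : z ^+ 2 * gauss (2 * b) z <= 2 / b * gauss b z.
Proof.
have -> : 2 * b = b + b by ring.
rewrite -gaussM mulrA ler_wpM2r ?gauss_ge0//.
rewrite /gauss expRN ler_pdivrMr ?expR_gt0//.
have := expR_ge1Dx (b * z ^+ 2 / 2).
rewrite -(ler_pM2l b_gt0 (z ^+ 2)).
have -> : b * (2 / b * expR (b * z ^+ 2 / 2)) = 2 * expR (b * z ^+ 2 / 2).
  by field; rewrite gt_eqF.
by lra.
Qed.

(** The test function is the Gaussian whose inverse Fourier transform is N times
    the Gaussian of the packet, so the value is the integral of an oscillating
    phase against h = N (packet) (Gaussian) >= 0.  The mass of h is at least
    N m / 2; the phase differs from the one on the plane xi_3 = 0 by an amount
    whose integral against h is at most N m / 4 on the given time interval. *)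
Lemma propagator_packet_ge (t : R) :
  8 * F * M * `|t| * a <= eps * b ->
  Num.sqrt (2 * pi ^+ 2) ^+ 3 / 4 <=
  normc (propagator eps F sgn (fun xi => (packet k M a b xi)%:C) t
    (fun x => (gauss3 a^-1 a^-1 b^-1 x)%:C)).
Proof.
move=> small.
have F_gt0 : 0 < F by apply: lt_trans F_gt1.
rewrite /propagator /difourier /regular.
rewrite (fourier_pair_ifourier (fourier_gauss3 aV_gt0 aV_gt0 bV_gt0)) !invrK -/N.
(* t0 is the phase on the plane xi_3 = 0 and e dominates |theta - t0| h *)
pose theta (xi : R3 R) := (-1) ^+ sgn * (eps^-1 * t * pF F xi).
pose t0 : R := (-1) ^+ sgn * (eps^-1 * t * F^-1).
pose h (xi : R3 R) := packet k M a b xi * (N * gauss3 a a b xi).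
pose ce : R := N * (eps^-1 * `|t|) * F * M * (a / b).
pose e (xi : R3 R) := ce * gauss3 (2 * a) (2 * a) b xi.
have -> : (fun xi => expi ((-1) ^+ sgn * (eps^-1 * t * pF F xi)) * (packet k M a b xi)%:C *
    (N * gauss3 a a b xi)%:C) = (fun xi => expi (theta xi) * (h xi)%:C).
  apply/funext => xi; rewrite -mulrA; congr (_ * _).
  by rewrite /h; simpc.
have ip := integrable_packet k M_ge0 a_gt0 b_gt0.
have h0 xi : 0 <= h xi by rewrite mulr_ge0 ?packet_ge0// mulr_ge0 ?gauss3_ge0// ltW.
have ih : mu3.-integrable setT (fun xi => (h xi)%:E).
  have -> : (fun xi => (h xi)%:E) = (fun xi => (N * gauss3 a a b xi * packet k M a b xi)%:E).
    by apply/funext => xi; rewrite /h mulrC.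
  apply: (@integrable_mulb _ _ _ _ _ _ N) => //.
    by apply: measurable_funM => //; exact: measurable_gauss3.
  move=> xi; have N0 := ltW N_gt0.
  by rewrite ger0_norm ?(mulr_ge0 N0 (gauss3_ge0 _ _ _ _))// ler_piMr// gauss3_le1.
have ie : mu3.-integrable setT (fun xi => (e xi)%:E).
  by apply: integrable_scale; exact: integrable_gauss3.
have mth : measurable_fun setT theta.
  apply: measurable_funM => //; apply: measurable_funM => //; exact: measurable_pF.
have the xi : `|theta xi - t0| * h xi <= e xi.
  have -> : theta xi - t0 = (-1) ^+ sgn * (eps^-1 * t * (pF F xi - F^-1)).
    by rewrite /theta /t0; ring.
  rewrite normrMsign !normrM normfV (gtr0_norm eps_gt0).
  have : packet k M a b xi <= M * a / 2 * xi.1.1 ^+ 2 * gauss3 a a b xi by exact: packet_upper.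
  have := pF_stationary xi F_gt1.
  have := sqr_gauss_le xi.2.
  set P := packet _ _ _ _ _; set d := `|pF F xi - F^-1|.
  move=> H1 H2 H3.
  have g2 : 0 <= gauss (2 * a) xi.1.1 * gauss (2 * a) xi.1.2.
    by rewrite mulr_ge0 ?gauss_ge0.
  have et : 0 <= eps^-1 * `|t| by rewrite mulr_ge0// invr_ge0 ltW.
  rewrite /h -/P.
  apply: (@le_trans _ _ (eps^-1 * `|t| * d *
    (M * a / 2 * xi.1.1 ^+ 2 * gauss3 a a b xi * (N * gauss3 a a b xi)))).
    apply: ler_wpM2l; first exact: (mulr_ge0 et (normr_ge0 _)).
    by apply: ler_wpM2r => //; exact: (mulr_ge0 (ltW N_gt0) (gauss3_ge0 _ _ _ _)).
  have -> : eps^-1 * `|t| * d * (M * a / 2 * xi.1.1 ^+ 2 *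
      gauss3 a a b xi * (N * gauss3 a a b xi)) =
    eps^-1 * `|t| * N * (M * a / 2) * (d * xi.1.1 ^+ 2) *
      (gauss3 a a b xi * gauss3 a a b xi) by ring.
  rewrite gauss3_sqr.
  have c0 : 0 <= eps^-1 * `|t| * N * (M * a / 2).
    apply: (mulr_ge0 (mulr_ge0 et (ltW N_gt0))).
    by rewrite divr_ge0// mulr_ge0// ltW.
  apply: (@le_trans _ _ (eps^-1 * `|t| * N * (M * a / 2) * (F * xi.2 ^+ 2) *
    gauss3 (2 * a) (2 * a) (2 * b) xi)).
    by rewrite ler_wpM2r ?gauss3_ge0// ler_wpM2l.
  rewrite /e /ce /gauss3.
  have -> : eps^-1 * `|t| * N * (M * a / 2) * (F * xi.2 ^+ 2) *
     (gauss (2 * a) xi.1.1 * gauss (2 * a) xi.1.2 * gauss (2 * b) xi.2) =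
     (eps^-1 * `|t| * N * (M * a / 2) * F) * (gauss (2 * a) xi.1.1 * gauss (2 * a) xi.1.2) *
     (xi.2 ^+ 2 * gauss (2 * b) xi.2) by ring.
  have -> : N * (eps^-1 * `|t|) * F * M * (a / b) *
     (gauss (2 * a) xi.1.1 * gauss (2 * a) xi.1.2 * gauss b xi.2) =
     (eps^-1 * `|t| * N * (M * a / 2) * F) * (gauss (2 * a) xi.1.1 * gauss (2 * a) xi.1.2) *
     (2 / b * gauss b xi.2) by field; rewrite !gt_eqF.
  apply: ler_wpM2l => //; apply: mulr_ge0 => //.
  exact: (mulr_ge0 c0 (ltW F_gt0)).
apply: le_trans (normc_oscillation mth ih h0 ie the).
have -> : \int[mu3]_x e x = ce * gauss3_mass (2 * a) (2 * a) b.
  by rewrite RintegralZl//; [rewrite Rintegral_gauss3|exact: integrable_gauss3].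
have hm : N * (m / 2) <= \int[mu3]_x h x.
  (* the lower bound for h given by [packet_lower] *)
  pose l (xi : R3 R) := N * (gauss3 (2 * a) (2 * a) (2 * b) xi -
     k%:R * gauss3 (2 * a + M * a) (2 * a) (2 * b) xi).
  have i1 := integrable_gauss3 a2_gt0 a2_gt0 b2_gt0.
  have i2 := integrable_gauss3 aM_gt0 a2_gt0 b2_gt0.
  have i3 := integrable_sub i1 (integrable_scale k%:R i2).
  have il : mu3.-integrable setT (fun xi => (l xi)%:E) := integrable_scale N i3.
  apply: (@le_trans _ _ (\int[mu3]_x l x)).
    rewrite (RintegralZl N measurableT i3).
    rewrite (RintegralB measurableT i1 (integrable_scale k%:R i2)).
    rewrite (RintegralZl k%:R measurableT i2) !Rintegral_gauss3// -/m.
    rewrite ler_pM2l//; have := mass_cut; lra.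
  apply: le_Rintegral => // xi _; rewrite /l /h [leRHS]mulrCA.
  apply: ler_wpM2l; first exact: ltW.
  have -> : gauss3 (2 * a) (2 * a) (2 * b) xi -
     k%:R * gauss3 (2 * a + M * a) (2 * a) (2 * b) xi =
     (gauss3 a a b xi - k%:R * gauss3 (a + M * a) a b xi) * gauss3 a a b xi.
    have -> : gauss3 (2 * a + M * a) (2 * a) (2 * b) xi =
        gauss3 (a + M * a) a b xi * gauss3 a a b xi.
      by rewrite gauss3M !(mulr_natl _ 2) !mulr2n addrAC.
    by rewrite -gauss3_sqr mulrA -mulrBl.
  by rewrite ler_wpM2r ?gauss3_ge0// packet_lower.
have -> : Num.sqrt (2 * pi ^+ 2) ^+ 3 / 4 = N * m / 4.
  by rewrite -(gauss3_massM a_gt0 a_gt0 b_gt0).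
have : ce * gauss3_mass (2 * a) (2 * a) b <= N * m / 4.
  have ce0 : 0 <= ce.
    by rewrite /ce !mulr_ge0 ?invr_ge0 ?(ltW N_gt0)// ltW.
  apply: le_trans (ler_wpM2l ce0 mass_err) _.
  have -> : ce * (2 * m) = N * m * (2 * (eps^-1 * `|t|) * F * M * (a / b)).
    by rewrite /ce; ring.
  have Nm_gt0 : 0 < N * m := mulr_gt0 N_gt0 m_gt0.
  rewrite (ler_pM2l Nm_gt0).
  have -> : 2 * (eps^-1 * `|t|) * F * M * (a / b) = 4^-1 * (8 * F * M * `|t| * a / (eps * b)).
    by field; rewrite !gt_eqF.
  by rewrite ler_piMr// ler_pdivrMr ?mulr_gt0// mul1r.
move: hm; lra.
Qed.

End PacketEvolution.

(** * Sobolev and mixed norms *)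

Section SobolevNorm.
Variable R : realType.
Local Notation mu3 := (lebesgue3 R).
Local Open Scope complex_scope.
Implicit Types (a b M s r : R) (x xi : R3 R).

Lemma powR_expR_bound (p : R) : 0 <= p ->
  exists K : R, 0 <= K /\ forall r, 0 <= r -> r `^ p * expR (- (r / 2)) <= K.
Proof.
move=> p0; pose n := (Num.truncn p).+1.
have pn : p <= n%:R by apply/ltW; exact: truncnS_gt.
exists (2 ^+ n * n`!%:R * expR (1 / 2)); split.
  by rewrite mulr_ge0 ?expR_ge0// mulr_ge0.
move=> r r0; rewrite expRN ler_pdivrMr ?expR_gt0//.
have r1 : 0 <= 1 + r by rewrite addr_ge0.
apply: (@le_trans _ _ ((1 + r) ^+ n)).
  apply: (@le_trans _ _ ((1 + r) `^ p)); first by rewrite ge0_ler_powR// lerDr.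
  by rewrite -powR_mulrn// ler_powR// lerDl.
have -> : (1 + r) ^+ n = 2 ^+ n * ((1 + r) / 2) ^+ n.
  by rewrite -exprMn; congr (_ ^+ _); field.
rewrite -!mulrA ler_pM2l ?exprn_gt0// -expRD -mulrDl.
by apply: exprn_le_expR; rewrite divr_ge0.
Qed.

Lemma gauss3_le_enorm a b xi : a <= b -> gauss3 a a b xi <= expR (- (a * enorm xi ^+ 2 / 2)).
Proof.
move=> ab; rewrite /gauss3 /gauss -!expRD ler_expR enorm_sqr.
have := ler_wpM2r (sqr_ge0 xi.2) ab; lra.
Qed.

(** Put r = a |xi|^2.  Then |xi|^(2s) = a^(-s) r^s and the square of the
    cut-off factor is at most (M r/2)^(2k).  As b >= a, one of the two
    Gaussians in the square of the packet is at most e^(-r/2), which absorbs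
    r^(2k + s) because 2k + s >= 0.  At xi = 0 the packet vanishes. *)
Lemma packet_sobolev (s M : R) (k : nat) : (0 < k)%N -> 0 <= M -> 0 <= k%:R *+ 2 + s ->
  exists K : R, 0 <= K /\ forall a b xi, 0 < a -> a <= b ->
  packet k M a b xi ^+ 2 * enorm xi `^ (2 * s) <= K * a `^ (- s) * gauss3 a a b xi.
Proof.
move=> k0 M0 ks; have [K [K0 HK]] := powR_expR_bound ks.
exists ((M / 2) ^+ k.*2 * K); split.
  by rewrite mulr_ge0// exprn_ge0// divr_ge0.
move=> a b xi a0 ab.
have b0 : 0 < b by apply: lt_le_trans ab.
have g0 := gauss3_ge0 a a b xi.
(* the power of |xi| may be negative, so the origin is treated apart *)
have [E0|E0] := eqVneq (enorm xi) 0.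
  have x0 : xi.1.1 = 0.
    by apply/eqP; rewrite -normr_le0 -E0; exact: norm_x1_le.
  rewrite /packet x0 {1}/gauss !expr0n/= mulr0 mul0r oppr0 expR0 subrr
    expr0n gtn_eqF//= mul0r expr0n/= mul0r.
  by rewrite mulr_ge0// mulr_ge0 ?powR_ge0// mulr_ge0// exprn_ge0// divr_ge0.
have Egt0 : 0 < enorm xi by rewrite lt_def E0 enorm_ge0.
pose r := a * enorm xi ^+ 2.
have r0 : 0 < r by rewrite mulr_gt0// exprn_gt0.
have u0 : 0 <= 1 - gauss (M * a) xi.1.1.
  by rewrite subr_ge0 gauss_le1// mulr_ge0// ltW.
have ur : 1 - gauss (M * a) xi.1.1 <= M / 2 * r.
  apply: (le_trans (one_sub_gauss_le _ _)).
  have -> : M * a * xi.1.1 ^+ 2 / 2 = M / 2 * (a * xi.1.1 ^+ 2) by ring.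
  rewrite ler_wpM2l ?divr_ge0// ler_pM2l// enorm_sqr -addrA lerDl.
  by rewrite addr_ge0 ?sqr_ge0.
have Epow : enorm xi `^ (2 * s) = a `^ (- s) * r `^ s.
  rewrite powRrM powR_mulrn ?enorm_ge0//.
  have -> : enorm xi ^+ 2 = a^-1 * r by rewrite /r mulrA mulVf ?mul1r// gt_eqF.
  rewrite powRM ?invr_ge0 ?(ltW a0) ?(ltW r0)//; congr (_ * _).
  by rewrite -powR_inv1 ?(ltW a0)// -powRrM mulN1r.
have u2 : (1 - gauss (M * a) xi.1.1) ^+ k.*2 <= (M / 2) ^+ k.*2 * r `^ (k%:R *+ 2).
  have -> : k%:R *+ 2 = k.*2%:R :> R by rewrite -muln2 natrM mulr_natr.
  rewrite powR_mulrn ?(ltW r0)// -exprMn.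
  by apply: lerXn2r ur; rewrite nnegrE// mulr_ge0 ?divr_ge0// ltW.
rewrite Epow.
have -> : packet k M a b xi ^+ 2 =
    (1 - gauss (M * a) xi.1.1) ^+ k.*2 * gauss3 a a b xi * gauss3 a a b xi.
  by rewrite /packet exprMn -exprM muln2 [X in _ * X]expr2 mulrA.
apply: (@le_trans _ _ ((M / 2) ^+ k.*2 * r `^ (k%:R *+ 2) * gauss3 a a b xi *
    expR (- (r / 2)) * (a `^ (- s) * r `^ s))).
  apply: ler_wpM2r; first by rewrite mulr_ge0 ?powR_ge0.
  apply: ler_pM => //; first by rewrite mulr_ge0// exprn_ge0.
    by apply: ler_wpM2r.
  exact: gauss3_le_enorm.
have -> : (M / 2) ^+ k.*2 * r `^ (k%:R *+ 2) * gauss3 a a b xi *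
    expR (- (r / 2)) * (a `^ (- s) * r `^ s) =
  (M / 2) ^+ k.*2 * (r `^ (k%:R *+ 2) * r `^ s * expR (- (r / 2))) *
    a `^ (- s) * gauss3 a a b xi by ring.
rewrite -powRD; last by rewrite (gt_eqF r0) implybT.
apply: ler_wpM2r => //; apply: ler_wpM2r; first exact: powR_ge0.
apply: ler_wpM2l; first by rewrite exprn_ge0// divr_ge0.
by apply: HK; exact: ltW.
Qed.

Lemma Hdot_norm_packet (s M : R) (k : nat) : (0 < k)%N -> 0 <= M -> 0 <= k%:R *+ 2 + s ->
  exists K : R, 0 <= K /\ forall a b, 0 < a -> a <= b ->
  (Hdot_norm s (fun xi => (packet k M a b xi)%:C) <=
    ((K * a `^ (- s) * gauss3_mass a a b) `^ (1 / 2))%:E)%E.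
Proof.
move=> k0 M0 ks; have [K [K0 HK]] := packet_sobolev k0 M0 ks.
exists K; split => // a b a0 ab.
have b0 : 0 < b by apply: lt_le_trans ab.
have i0 : 0 <= K * a `^ (- s) * gauss3_mass a a b.
  by rewrite !mulr_ge0 ?powR_ge0 ?sqrtr_ge0.
rewrite /Hdot_norm -poweR_EFin; apply: gt0_ler_poweR => //.
- by rewrite in_itv/= leey andbT integral_ge0// => x _; rewrite lee_fin mulr_ge0 ?sqr_ge0 ?powR_ge0.
- by rewrite in_itv/= leey andbT lee_fin.
have ig := integrable_gauss3 a0 a0 b0.
rewrite -(Rintegral_gauss3 a0 a0 b0) -(RintegralZl (K * a `^ (- s)) measurableT ig).
rewrite EFin_Rintegral; last exact: integrable_scale.
apply: ge0_le_integralT => xi.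
  by rewrite lee_fin mulr_ge0 ?sqr_ge0 ?powR_ge0.
by rewrite lee_fin normc_real real_normK ?num_real//; exact: HK.
Qed.

End SobolevNorm.

Section MixedNorm.
Variable R : realType.
Local Notation mu := (@lebesgue_measure R).

(** The norm is compared with that of rho times the indicator of
    [-tau, tau]. *)
Lemma LpLq_norm_ge (p q : \bar R) (u : R -> (R3 R -> R[i]) -> R[i]) (rho tau : R) :
  (2%:E <= p)%E -> 0 <= rho -> 0 < tau ->
  (forall t, `|t| <= tau -> (rho%:E <= dist_Lq_norm q (u t))%E) ->
  ((rho * (2 * tau) `^ fine (p^-1)%E)%:E <= LpLq_norm p q u)%E.
Proof.
move=> p2 rho0 tau0 H.
pose J : set R := `[- tau, tau]%classic.
have mI : measurable J by exact: measurable_itv.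
have mE : mu J = (2 * tau)%:E.
  rewrite /J lebesgue_measure_itv/= lte_fin gtrN// -EFinB opprK.
  by rewrite mulr_natl mulr2n.
have inI t : J t -> `|t| <= tau.
  by rewrite /J/= in_itv/= ler_norml.
rewrite /LpLq_norm unlock; case: p p2 => [r r2|_|//].
- have r0 : 0 < r by apply: lt_le_trans (_ : 2 <= r) => //; rewrite -lee_fin.
  have -> : fine (r%:E^-1)%E = r^-1 by rewrite inver gt_eqF.
  have -> : rho * (2 * tau) `^ r^-1 = (rho `^ r * (2 * tau)) `^ r^-1.
    rewrite [RHS]powRM ?powR_ge0 ?mulr_ge0 ?(ltW tau0)// -powRrM mulfV ?gt_eqF//.
    by rewrite powRr1.
  rewrite -poweR_EFin; apply: gt0_ler_poweR.
  + by rewrite invr_ge0 ltW.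
  + by rewrite in_itv/= leey andbT lee_fin !mulr_ge0 ?powR_ge0 ?(ltW tau0).
  + by rewrite in_itv/= leey andbT integral_ge0// => x _; exact: poweR_ge0.
  rewrite EFinM -mE.
  have <- : (\int[mu]_x (rho `^ r * \1_J x)%:E =
      (rho `^ r)%:E * mu J)%E.
    under eq_integral do rewrite EFinM.
    rewrite ge0_integralZl_EFin ?powR_ge0//; first by rewrite integral_indic// setIT.
    by apply/measurable_EFinP; exact: measurable_indic.
  apply: ge0_le_integralT => t; first by rewrite lee_fin mulr_ge0 ?powR_ge0.
  rewrite indicE; case: (boolP (t \in _)) => [/set_mem/inI tI|_]; last first.
    by rewrite mulr0 poweR_ge0.
  rewrite mulr1 -poweR_EFin; have Ht := H t tI.
  have D0 : (0 <= dist_Lq_norm q (u t))%E by apply: le_trans Ht; rewrite lee_fin.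
  rewrite gee0_abs//; apply: gt0_ler_poweR => //; first exact: ltW.
  + by rewrite in_itv/= leey andbT lee_fin.
  + by rewrite in_itv/= leey andbT.
- rewrite invey/= powRr0 mulr1.
  have muT : (0 < mu setT)%E.
    apply: (@lt_le_trans _ _ (mu J)).
      by rewrite mE lte_fin mulr_gt0.
    by apply: le_measure => //; rewrite inE.
  rewrite muT leNgt; apply/negP => Lrho.
  have [A [mA A0 subA]] := ess_sup_ge mu (abse \o (fun t => dist_Lq_norm q (u t))).
  have : (mu J <= mu A)%E.
    apply: le_measure; rewrite ?inE// => t /inI tI; apply: subA => /=.
    apply/negP; rewrite -ltNge; apply: (lt_le_trans Lrho).
    exact: le_trans (H t tI) (lee_abs _).
  by rewrite A0 mE lee_fin leNgt mulr_gt0.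
Qed.

End MixedNorm.

(** * The exponents *)

Section PowerGrowth.
Variable R : realType.
Implicit Types (a b D : R).

(** Otherwise x^(al - be) would be unbounded. *)
Lemma powR_growth (al be D : R) : (forall x, 1 <= x -> x `^ al <= D * x `^ be) -> al <= be.
Proof.
move=> H; rewrite leNgt; apply/negP => ba.
have d0 : 0 < al - be by rewrite subr_gt0.
pose y := Num.max D 1 + 1.
have y1 : 1 <= y by rewrite lerDr le_max ler01 orbT.
have y0 : 0 < y by apply: lt_le_trans y1.
pose x := y `^ (al - be)^-1.
have x1 : 1 <= x by rewrite -(powRr0 y) /x ler_powR// invr_ge0 ltW.
have x0 : 0 < x by apply: lt_le_trans x1.
have := H x x1.
have -> : x `^ al = y * x `^ be.
  have -> : y = x `^ (al - be) by rewrite /x -powRrM mulVf ?gt_eqF// powRr1// ltW.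
  by rewrite -powRD ?subrK// (gt_eqF x0) implybT.
rewrite ler_pM2r ?powR_gt0// leNgt => /negP; apply.
by rewrite (@le_lt_trans _ _ (Num.max D 1)) ?le_max ?lexx// ltrDl.
Qed.

Lemma gauss3_mass_inv a b : 0 < a -> 0 < b ->
  gauss3_mass a^-1 a^-1 b^-1 = 2 * pi * Num.sqrt (2 * pi) * (a * b `^ 2^-1).
Proof.
move=> a0 b0; have pi2 : 0 <= 2 * pi :> R by rewrite mulr_ge0 ?pi_ge0.
rewrite /gauss3_mass !invrK -expr2 sqr_sqrtr; last by rewrite mulr_ge0// ltW.
by rewrite sqrtrM// powR12_sqrt ?ltW//; ring.
Qed.

Lemma gauss3_mass_pow a b : 0 < a -> 0 < b ->
  gauss3_mass a a b = 2 * pi * Num.sqrt (2 * pi) * (a `^ (- 1) * b `^ (- 2^-1)).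
Proof.
move=> a0 b0; have aV : 0 < a^-1 by rewrite invr_gt0.
have bV : 0 < b^-1 by rewrite invr_gt0.
have := gauss3_mass_inv aV bV; rewrite !invrK => ->.
by rewrite -!powR_inv1 ?ltW// -powRrM mulN1r.
Qed.

End PowerGrowth.

Section Necessity.
Variable R : realType.
Variables (eps F : R) (p q : \bar R) (s : R) (sgn : bool).
Hypotheses (eps_gt0 : 0 < eps) (F_gt1 : 1 < F).
Hypotheses (p_ge2 : (2%:E <= p)%E) (q_ge2 : (2%:E <= q)%E).
Variable C : R.
Local Open Scope complex_scope.
Hypothesis strichartz : forall (g : (R3 R -> R[i]) -> R[i]) (ghat : R3 R -> R[i]),
  in_Hdot s g ghat ->
  (LpLq_norm p q (propagator eps F sgn ghat) <= C%:E * Hdot_norm s ghat)%E.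

Let rp : R := fine (p^-1)%E.
Let rq : R := fine (q^-1)%E.

(** The left-hand side is the L^p norm over |t| <= tau, with tau proportional to
    b/a, of the lower bound for the L^q norms; the right-hand side is the
    Sobolev norm of the packet.  Both carry their constants in D. *)
Lemma strichartz_packets : exists D : R, forall a b, 0 < a -> a <= b ->
  (b / a) `^ rp * (a * b `^ 2^-1) `^ (- (1 - rq)) <=
  D * (a `^ (- s) * (a `^ (- 1) * b `^ (- 2^-1))) `^ 2^-1.
Proof.
have F_gt0 : 0 < F by apply: lt_trans F_gt1.
(* large enough for 2k + s >= 0, the condition of [packet_sobolev] *)
pose k := (Num.truncn `|s|).+1.
have k0 : (0 < k)%N by [].
have ks : 0 <= k%:R *+ 2 + s.
  have h1 : `|s| <= k%:R by apply/ltW; exact: truncnS_gt.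
  have := ler_norm (- s); rewrite normrN mulr2n => h2.
  by have := le_trans h2 h1; have := ler0n R k; lra.
pose M : R := 8 * k%:R ^+ 2.
have M_gt0 : 0 < M by rewrite mulr_gt0// exprn_gt0// ltr0n.
have M_ge0 := ltW M_gt0.
have [K [K0 HK]] := Hdot_norm_packet k0 M_ge0 ks.
pose c0 : R := 2 * pi * Num.sqrt (2 * pi).
have c0_gt0 : 0 < c0 by rewrite !mulr_gt0 ?sqrtr_gt0 ?mulr_gt0 ?pi_gt0.
pose A : R := Num.sqrt (2 * pi ^+ 2) ^+ 3 / 4.
have A_gt0 : 0 < A.
  by rewrite divr_gt0// exprn_gt0// sqrtr_gt0 mulr_gt0// exprn_gt0// pi_gt0.
pose T1 : R := 2 * (eps / (8 * F * M)).
have T1_gt0 : 0 < T1 by rewrite mulr_gt0// divr_gt0// !mulr_gt0.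
pose c1 : R := A / (2 * c0 `^ (1 - rq)) * T1 `^ rp.
have c1_gt0 : 0 < c1 by rewrite mulr_gt0 ?powR_gt0// divr_gt0// mulr_gt0// powR_gt0.
exists (c1^-1 * (`|C| * (K * c0) `^ 2^-1)) => a b a0 ab.
have b0 : 0 < b by apply: lt_le_trans ab.
have [G Gh] := packet_fourier_pair k M_ge0 a0 b0.
have ih := integrable_packet k M_ge0 a0 b0.
have hdot := HK a b a0 ab.
have inH : in_Hdot s (regular (fun x => (G x)%:C)) (fun xi => (packet k M a b xi)%:C).
  by apply: in_Hdot_regular => //; apply: le_lt_trans hdot _; exact: ltry.
have := strichartz inH.
pose N := gauss3_mass a^-1 a^-1 b^-1.
pose tau := eps / (8 * F * M) * (b / a).
have tau_gt0 : 0 < tau by rewrite mulr_gt0 ?divr_gt0// !mulr_gt0.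
have aV : 0 < a^-1 by rewrite invr_gt0.
have bV : 0 < b^-1 by rewrite invr_gt0.
have N_gt0 : 0 < N by exact: gauss3_mass_gt0.
have rho_ge0 : 0 <= A / (2 * N `^ (1 - rq)).
  by rewrite divr_ge0 ?mulr_ge0 ?powR_ge0// ltW.
have lower := @LpLq_norm_ge R p q
  (propagator eps F sgn (fun xi => (packet k M a b xi)%:C)) _ _ p_ge2 rho_ge0 tau_gt0.
have {}lower := lower _.
move=> upper.
have real_ineq : A / (2 * N `^ (1 - rq)) * (2 * tau) `^ rp <=
    `|C| * (K * a `^ (- s) * gauss3_mass a a b) `^ (1 / 2).
  rewrite -lee_fin; apply: le_trans (lower _) _.
    move=> t ttau; apply: dist_Lq_norm_ge => //.
    apply: propagator_packet_ge => //.
    have -> : eps * b = 8 * F * M * tau * a.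
      by rewrite /tau; field; rewrite !gt_eqF.
    by rewrite ler_pM2r// ler_pM2l// !mulr_gt0.
  apply: (le_trans upper); rewrite EFinM.
  apply: (@le_trans _ _ (`|C|%:E * Hdot_norm s (fun xi => (packet k M a b xi)%:C))%E).
    by apply: lee_wpmul2r; [exact: poweR_ge0|rewrite lee_fin ler_norm].
  by apply: lee_wpmul2l; [rewrite lee_fin|exact: hdot].
move: real_ineq.
pose n := a * b `^ 2^-1; pose v := a `^ (- 1) * b `^ (- 2^-1).
have n_gt0 : 0 < n by rewrite mulr_gt0 ?powR_gt0.
have v_ge0 : 0 <= v by rewrite mulr_ge0 ?powR_ge0.
have av_ge0 : 0 <= a `^ (- s) * v by rewrite mulr_ge0 ?powR_ge0.
rewrite /N gauss3_mass_inv// gauss3_mass_pow// -/c0 -/n -/v div1r.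
have -> : (c0 * n) `^ (1 - rq) = c0 `^ (1 - rq) * n `^ (1 - rq).
  by rewrite powRM// ltW.
have -> : (2 * tau) `^ rp = T1 `^ rp * (b / a) `^ rp.
  rewrite -powRM ?(ltW T1_gt0) ?divr_ge0 ?(ltW a0) ?(ltW b0)//.
  by congr powR; rewrite /tau /T1 mulrA.
have -> : K * a `^ (- s) * (c0 * v) = K * c0 * (a `^ (- s) * v) by ring.
have -> : (K * c0 * (a `^ (- s) * v)) `^ 2^-1 = (K * c0) `^ 2^-1 * (a `^ (- s) * v) `^ 2^-1.
  by rewrite powRM// mulr_ge0// ltW.
move=> ineq.
have -> : (b / a) `^ rp * n `^ (- (1 - rq)) = c1^-1 *
    (A / (2 * (c0 `^ (1 - rq) * n `^ (1 - rq))) * (T1 `^ rp * (b / a) `^ rp)).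
  by rewrite powRN /c1; field; rewrite !gt_eqF ?powR_gt0.
have -> : c1^-1 * (`|C| * (K * c0) `^ 2^-1) * (a `^ (- s) * v) `^ 2^-1 =
    c1^-1 * (`|C| * ((K * c0) `^ 2^-1 * (a `^ (- s) * v) `^ 2^-1)) by ring.
by rewrite ler_pM2l// invr_gt0.
Qed.

(** On the diagonal b = a both sides are powers of a; a >= 1 gives one
    inequality between the exponents and a <= 1 the other. *)
Lemma scaling_exponent : s = 3 * (1 / 2 - rq).
Proof.
have [D HD] := strichartz_packets.
have H a : 0 < a -> a `^ (- (3 / 2 * (1 - rq))) <= D * a `^ (- (s / 2 + 3 / 4)).
  move=> a0; have := HD a a a0 (lexx a).
  have an0 : (a == 0) = false by rewrite gt_eqF.
  rewrite divff ?gt_eqF// powR1 mul1r.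
  have -> : a * a `^ 2^-1 = a `^ (3 / 2).
    rewrite -[X in X * _](powRr1 (ltW a0)) -powRD ?an0 ?implybT//.
    by congr powR; field.
  have -> : a `^ (- s) * (a `^ (-1) * a `^ (- 2^-1)) = a `^ (- s - 3 / 2).
    by rewrite -!powRD ?an0 ?implybT//; congr powR; field.
  by rewrite -!powRrM; congr (a `^ _ <= D * a `^ _); field.
have h1 := powR_growth (fun x (x1 : 1 <= x) => H x (lt_le_trans ltr01 x1)).
have h2 : 3 / 2 * (1 - rq) <= s / 2 + 3 / 4.
  apply: (@powR_growth R _ _ D) => x x1; have x0 := lt_le_trans ltr01 x1.
  have xV0 : 0 < x^-1 by rewrite invr_gt0.
  have := H _ xV0; rewrite -(powR_inv1 (ltW x0)) -!powRrM.
  by rewrite !mulN1r !opprK.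
by move: h1 h2; lra.
Qed.

(** Here a = 1 and b tends to infinity. *)
Lemma knapp_exponent : 2 * rp + rq <= 1 / 2.
Proof.
have [D HD] := strichartz_packets.
have : rp - (1 - rq) / 2 <= - (1 / 4).
  apply: (@powR_growth R _ _ D) => b b1; have b0 := lt_le_trans ltr01 b1.
  have := HD 1 b ltr01 b1.
  have bn0 : (b == 0) = false by rewrite gt_eqF.
  rewrite divr1 !powR1 !mul1r -!powRrM -powRD ?bn0 ?implybT//.
  by congr (b `^ _ <= D * b `^ _); field.
by lra.
Qed.

End Necessity.

Lemma inve_ge2 (R : realType) (p : \bar R) : (2%:E <= p)%E -> (p^-1 = (fine p^-1)%:E)%E.
Proof.
case: p => [r r2|_|//]; last by rewrite invey.
have r0 : 0 < r by apply: lt_le_trans (_ : 2 <= r) => //; rewrite -lee_fin.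
by rewrite inver gt_eqF.
Qed.

Theorem proposition1 (R : realType) (eps F : R) (p q : \bar R) (s : R)
    (sgn : bool)
    (eps_gt0 : 0 < eps) (F_gt1 : 1 < F)
    (p_ge2 : (2%:E <= p)%E) (q_ge2 : (2%:E <= q)%E)
    (strichartz : exists C : R,
       forall (g : (R3 R -> R[i]) -> R[i]) (ghat : R3 R -> R[i]),
         in_Hdot s g ghat ->
         (LpLq_norm p q (propagator eps F sgn ghat)
            <= C%:E * Hdot_norm s ghat)%E) :
  (2%:E / p + 1 / q <= (1 / 2)%:E)%E /\
  (s%:E = 3%:E * ((1 / 2)%:E - 1 / q))%E.
Proof.
have [C HC] := strichartz.
rewrite (inve_ge2 p_ge2) (inve_ge2 q_ge2) mul1e -EFinM -EFinD -EFinB -EFinM lee_fin.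
split; first exact: (knapp_exponent eps_gt0 F_gt1 p_ge2 q_ge2 HC).
by congr EFin; exact: (scaling_exponent eps_gt0 F_gt1 p_ge2 q_ge2 HC).
Qed.
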